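(* Let $f\colon M^n\to\mathbb{R}^m$ be an isometric immersion of a simply connected Riemannian manifold, with second fundamental form $\alpha$ and normal bundle $N_fM$. Let $\beta\colon TM\times TM\to N_fM$ be a symmetric tensor and let $\mathcal{E}\colon TM\times N_fM\to N_fM$ be a tensor satisfying $\langle\mathcal{E}(X,\eta),\xi\rangle+\langle\mathcal{E}(X,\xi),\eta\rangle=0$ for all $X\in\mathfrak{X}(M)$, $\eta,\xi\in\Gamma(N_fM)$. Assume $(\beta,\mathcal{E})\neq 0$ and that, for all $X,Y,Z\in\mathfrak{X}(M)$ and $\eta\in\Gamma(N_fM)$, $$A_{\beta(Y,Z)}X+B_{\alpha(Y,Z)}X=A_{\beta(X,Z)}Y+B_{\alpha(X,Z)}Y,$$ $$(\nabla^\perp_X\beta)(Y,Z)-(\nabla^\perp_Y\beta)(X,Z)=\mathcal{E}(Y,\alpha(X,Z))-\mathcal{E}(X,\alpha(Y,Z)),$$ $$(\nabla^\perp_X\mathcal{E})(Y,\eta)-(\nabla^\perp_Y\mathcal{E})(X,\eta)=\beta(X,A_\eta Y)-\beta(A_\eta X,Y)+\alpha(X,B_\eta Y)-\alpha(B_\eta X,Y),$$ where $\langle A_\eta X,Y\rangle=\langle\alpha(X,Y),\eta\rangle$ and $\langle B_\eta X,Y\rangle=\langle\beta(X,Y),\eta\rangle$. Then there is an infinitesimal bending $\mathcal{T}$ of $f$, unique up to adding trivial infinitesimal bendings, having $(\beta,\mathcal{E})$ as associated pair up to the identification of pairs; that is, the associated pair $(\tilde\beta,\tilde{\mathcal{E}})$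 of $\mathcal{T}$ satisfies $\tilde\beta(X,Y)=\beta(X,Y)+C\alpha(X,Y)$ and $\tilde{\mathcal{E}}(X,\eta)=\mathcal{E}(X,\eta)-(\nabla^\perp_XC)\eta$ for some skew-symmetric $C\in\Gamma(\mathrm{End}(N_fM))$.
   Context: $\mathbb{R}^m$ carries its standard metric; $\nabla$ and $\tilde\nabla$ are the Levi-Civita connections of $M^n$ and $\mathbb{R}^m$ (the latter also acting on sections of $f^*T\mathbb{R}^m$), and $\nabla^\perp$ is the normal connection; covariant derivatives of tensors are the usual ones, e.g. $(\nabla^\perp_X\mathcal{E})(Y,\eta)=\nabla^\perp_X\mathcal{E}(Y,\eta)-\mathcal{E}(\nabla_XY,\eta)-\mathcal{E}(Y,\nabla^\perp_X\eta)$ and $(\nabla^\perp_XC)\eta=\nabla^\perp_X(C\eta)-C\nabla^\perp_X\eta$. $TM$ is identified with $f_*TM$ when convenient; $(\cdot)_{N_fM}$ denotes the normal component. An infinitesimal bending of $f$ is a section $\mathcal{T}\in\Gamma(f^*T\mathbb{R}^m)$ with $\langle\tilde\nabla_X\mathcal{T},f_*Y\rangle+\langle f_*X,\tilde\nabla_Y\mathcal{T}\rangle=0$ for all $X,Y\in\mathfrak{X}(M)$. It is trivial if $\mathcal{T}=\mathcal{D}f+v$ for some skew-symmetric linear endomorphism $\mathcal{D}$ of $\mathbb{R}^m$ and some $v\in\mathbb{R}^m$. Associated pair of an infinitesimal bending $\mathcal{T}$: set $LX=\tilde\nabla_X\mathcal{T}$ and $B(X,Y)=(\tilde\nabla_XL)Y=\tilde\nabla_X(LY)-L\nabla_XY$.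 Let $\mathcal{Y}\colon N_fM\to f_*TM$ be the bundle map with $\langle\mathcal{Y}\eta,f_*X\rangle+\langle\eta,LX\rangle=0$ for all $X$. The associated pair consists of the tensors $(X,Y)\mapsto(B(X,Y))_{N_fM}$ (symmetric, with values in $N_fM$) and $(X,\eta)\mapsto\alpha(X,\mathcal{Y}\eta)+(LA_\eta X)_{N_fM}$. Convention: infinitesimal bendings differing by a trivial one are identified, and correspondingly pairs $(\beta_1,\mathcal{E}_1)$, $(\beta_2,\mathcal{E}_2)$ are identified if $\beta_2-\beta_1=C\alpha$ and $\mathcal{E}_2(X,\eta)-\mathcal{E}_1(X,\eta)=-(\nabla^\perp_XC)\eta$ for some skew-symmetric $C\in\Gamma(\mathrm{End}(N_fM))$. *)

(* Defs.v *)
From HB Require Import structures.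
From mathcomp Require Import all_boot all_order all_algebra.
From mathcomp Require Import all_classical all_reals all_analysis.

Set Implicit Arguments.
Unset Strict Implicit.
Unset Printing Implicit Defensive.

Import Order.TTheory GRing.Theory Num.Theory.
Import numFieldNormedType.Exports.

Local Open Scope classical_set_scope.
Local Open Scope ring_scope.

Section Euclidean.
Context {R : realType}.

(* The norm of 'rV[R]_m is the sup norm (same topology and calculus as the
   Euclidean one); the standard metric of R^m is [dotr]. *)
Definition dotr {m : nat} (u v : 'rV[R]_m) : R := (u *m v^T) 0 0.

(* For open U, [Ck k U F] says that F is of class C^k on U. *)
Fixpoint Ck (k : nat) (n : nat) (V : normedModType R) (U : set 'rV[R]_n)
    (F : 'rV[R]_n -> V) : Prop :=
  match k with
  | 0 => forall x, U x -> {for x, continuous F}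
  | k'.+1 => (forall x, U x -> differentiable F x) /\
             (forall v : 'rV[R]_n, Ck k' U (fun x => 'D_v F x))
  end.

Definition smooth_on (n : nat) (V : normedModType R) (U : set 'rV[R]_n)
  (F : 'rV[R]_n -> V) : Prop := forall k, Ck k U F.

End Euclidean.

(* A smooth atlas is indexed by the points of the manifold: [chart p] is a
   chart around p, with inverse [chart_inv p]; both are total functions, only
   meaningful on [chart_dom p] and [chart_img p].  Every smooth structure is
   given by such an atlas. *)
Record smoothManifold (R : realType) (n : nat) := SmoothManifold {
  carrier :> topologicalType;
  mfd_hausdorff : hausdorff_space carrier;
  mfd_second_countable : @second_countable carrier;
  chart_dom : carrier -> set carrier;
  chart_img : carrier -> set 'rV[R]_n;
  chart : carrier -> carrier -> 'rV[R]_n;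
  chart_inv : carrier -> 'rV[R]_n -> carrier;
  chart_dom_center : forall p, chart_dom p p;
  open_chart_dom : forall p, open (chart_dom p);
  open_chart_img : forall p, open (chart_img p);
  chart_in : forall p q, chart_dom p q -> chart_img p (chart p q);
  chart_inv_in : forall p y, chart_img p y -> chart_dom p (chart_inv p y);
  chartK : forall p q, chart_dom p q -> chart_inv p (chart p q) = q;
  chart_invK : forall p y, chart_img p y -> chart p (chart_inv p y) = y;
  chart_continuous : forall p q, chart_dom p q ->
    {for q, continuous (chart p)};
  chart_inv_continuous : forall p y, chart_img p y ->
    {for y, continuous (chart_inv p)};
  chart_compat : forall p q,
    smooth_on (chart_img p `&` chart_inv p @^-1` chart_dom q)
              (chart q \o chart_inv p)
}.

Definition simply_connected (R : realType) (M : topologicalType) : Prop :=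
  [/\ exists p : M, True,
      forall p q : M, exists gamma : R -> M,
        [/\ {within `[0, 1], continuous gamma}, gamma 0 = p & gamma 1 = q] &
      forall gamma : R -> M,
        {within `[0, 1], continuous gamma} -> gamma 0 = gamma 1 ->
        exists H : R * R -> M,
          [/\ {within `[0, 1] `*` `[0, 1], continuous H},
              forall t, t \in `[0, 1] -> H (0, t) = gamma t,
              forall t, t \in `[0, 1] -> H (1, t) = gamma 0 &
              forall s, s \in `[0, 1] ->
                H (s, 0) = gamma 0 /\ H (s, 1) = gamma 0]].

Section Manifold.
Context {R : realType}.
Context {n : nat} {M : smoothManifold R n}.

Definition smooth (V : normedModType R) (F : M -> V) : Prop :=
  forall p, smooth_on (chart_img p) (F \o chart_inv p).

(* The tangent space of M at p is 'rV[R]_n, a vector being identified with its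
   components in the chart [chart p]; [md F p v] is the derivative at p of F
   in the direction v. *)
Definition md (V : normedModType R) (F : M -> V) (p : M) (v : 'rV[R]_n) : V :=
  'D_v (F \o chart_inv p) (chart p p).

(* X is smooth when its components in every chart, given by the differential
   of that chart, are smooth. *)
Definition vfield (X : M -> 'rV[R]_n) : Prop :=
  forall p, smooth_on (chart_img p)
    (fun y => let q := chart_inv p y in md (chart p) q (X q)).

Record riemannian_metric (g : M -> 'rV[R]_n -> 'rV[R]_n -> R) : Prop :=
  RiemannianMetric {
  metric_linear : forall p u (a : R) v w,
    g p u (a *: v + w) = a * g p u v + g p u w;
  metric_sym : forall p u v, g p u v = g p v u;
  metric_pos : forall p u, u != 0 -> 0 < g p u u;
  metric_smooth : forall X Y, vfield X -> vfield Y ->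
    smooth (fun p => g p (X p) (Y p))
}.

Record levi_civita (g : M -> 'rV[R]_n -> 'rV[R]_n -> R)
    (nabla : (M -> 'rV[R]_n) -> (M -> 'rV[R]_n) -> (M -> 'rV[R]_n)) : Prop :=
  LeviCivita {
  lc_smooth : forall X Y, vfield X -> vfield Y -> vfield (nabla X Y);
  lc_addl : forall X Y Z, vfield X -> vfield Y -> vfield Z -> forall p,
    nabla (fun q => X q + Y q) Z p = nabla X Z p + nabla Y Z p;
  lc_addr : forall X Y Z, vfield X -> vfield Y -> vfield Z -> forall p,
    nabla X (fun q => Y q + Z q) p = nabla X Y p + nabla X Z p;
  lc_scalel : forall (h : M -> R) X Y, smooth h -> vfield X -> vfield Y ->
    forall p, nabla (fun q => h q *: X q) Y p = h p *: nabla X Y p;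
  lc_leibniz : forall (h : M -> R) X Y, smooth h -> vfield X -> vfield Y ->
    forall p, nabla X (fun q => h q *: Y q) p =
      md h p (X p) *: Y p + h p *: nabla X Y p;
  lc_torsion_free : forall X Y, vfield X -> vfield Y ->
    forall h : M -> R, smooth h -> forall p,
    md h p (nabla X Y p - nabla Y X p) =
      md (fun q => md h q (Y q)) p (X p) - md (fun q => md h q (X q)) p (Y p);
  lc_metric : forall X Y Z, vfield X -> vfield Y -> vfield Z -> forall p,
    md (fun q => g q (Y q) (Z q)) p (X p) =
      g p (nabla X Y p) (Z p) + g p (Y p) (nabla X Z p)
}.

End Manifold.

Section Immersion.
Context {R : realType} {n m : nat} {M : smoothManifold R n}.
Variable g : M -> 'rV[R]_n -> 'rV[R]_n -> R.
Variable nabla : (M -> 'rV[R]_n) -> (M -> 'rV[R]_n) -> (M -> 'rV[R]_n).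
Variable f : M -> 'rV[R]_m.
Implicit Types (X Y Z : M -> 'rV[R]_n) (eta xi T : M -> 'rV[R]_m) (p q : M).

Definition isometric_immersion : Prop :=
  [/\ smooth f, forall p, injective (md f p) &
      forall p u v, dotr (md f p u) (md f p v) = g p u v].

(* The fibre of the normal bundle at p. *)
Definition normal_vector p (w : 'rV[R]_m) : Prop :=
  forall v, dotr w (md f p v) = 0.

Definition normal_section eta : Prop :=
  smooth eta /\ forall p, normal_vector p (eta p).

Definition normal_part p (w : 'rV[R]_m) : 'rV[R]_m :=
  xget 0 [set xi | normal_vector p xi /\ exists v, w = md f p v + xi].

Definition normal_conn X eta p : 'rV[R]_m := normal_part p (md eta p (X p)).

(* Tensors are given by their pointwise values; those with an argument in the
   normal bundle are constrained only on normal vectors. *)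

Record tensor_TTN (beta : M -> 'rV[R]_n -> 'rV[R]_n -> 'rV[R]_m) : Prop :=
  TensorTTN {
  ttn_linearl : forall p v, linear (fun u => beta p u v);
  ttn_linearr : forall p u, linear (beta p u);
  ttn_normal : forall p u v, normal_vector p (beta p u v);
  ttn_smooth : forall X Y, vfield X -> vfield Y ->
    smooth (fun p => beta p (X p) (Y p))
}.

Record tensor_TNN (E : M -> 'rV[R]_n -> 'rV[R]_m -> 'rV[R]_m) : Prop :=
  TensorTNN {
  tnn_linearl : forall p w, normal_vector p w -> linear (fun u => E p u w);
  tnn_linearr : forall p u (a : R) w z,
    normal_vector p w -> normal_vector p z ->
    E p u (a *: w + z) = a *: E p u w + E p u z;
  tnn_normal : forall p u w, normal_vector p w -> normal_vector p (E p u w);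
  tnn_smooth : forall X eta, vfield X -> normal_section eta ->
    smooth (fun p => E p (X p) (eta p))
}.

Record skew_endo (C : M -> 'rV[R]_m -> 'rV[R]_m) : Prop := SkewEndo {
  se_linear : forall p (a : R) w z, normal_vector p w -> normal_vector p z ->
    C p (a *: w + z) = a *: C p w + C p z;
  se_normal : forall p w, normal_vector p w -> normal_vector p (C p w);
  se_smooth : forall eta, normal_section eta -> smooth (fun p => C p (eta p));
  se_skew : forall p w z, normal_vector p w -> normal_vector p z ->
    dotr (C p w) z + dotr w (C p z) = 0
}.

(* alpha is the second fundamental form of f: the tensor of the Gauss
   formula. *)
Definition second_fundamental_form
    (alpha : M -> 'rV[R]_n -> 'rV[R]_n -> 'rV[R]_m) : Prop :=
  tensor_TTN alpha /\
  forall X Y, vfield X -> vfield Y -> forall p,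
    md (fun q => md f q (Y q)) p (X p) =
      md f p (nabla X Y p) + alpha p (X p) (Y p).

(* The operator u |-> w with <w, v> = <beta(u, v), eta>: A_eta for
   beta = alpha, B_eta for a general beta. *)
Definition shape_op (beta : M -> 'rV[R]_n -> 'rV[R]_n -> 'rV[R]_m) p
    (eta : 'rV[R]_m) (u : 'rV[R]_n) : 'rV[R]_n :=
  xget 0 [set w | forall v, g p w v = dotr (beta p u v) eta].

Definition covder_TTN (beta : M -> 'rV[R]_n -> 'rV[R]_n -> 'rV[R]_m)
    X Y Z p : 'rV[R]_m :=
  normal_conn X (fun q => beta q (Y q) (Z q)) p
  - beta p (nabla X Y p) (Z p) - beta p (Y p) (nabla X Z p).

Definition covder_TNN (E : M -> 'rV[R]_n -> 'rV[R]_m -> 'rV[R]_m)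
    X Y eta p : 'rV[R]_m :=
  normal_conn X (fun q => E q (Y q) (eta q)) p
  - E p (nabla X Y p) (eta p) - E p (Y p) (normal_conn X eta p).

Definition covder_NN (C : M -> 'rV[R]_m -> 'rV[R]_m) X eta p : 'rV[R]_m :=
  normal_conn X (fun q => C q (eta q)) p - C p (normal_conn X eta p).

Definition infinitesimal_bending T : Prop :=
  smooth T /\
  forall X Y, vfield X -> vfield Y -> forall p,
    dotr (md T p (X p)) (md f p (Y p)) + dotr (md f p (X p)) (md T p (Y p)) = 0.

(* Row-vector convention: the endomorphism D acts by x |-> x *m D. *)
Definition trivial_bending T : Prop :=
  exists (D : 'M[R]_m) (v : 'rV[R]_m),
    D^T = - D /\ forall p, T p = f p *m D + v.

Definition assoc_beta T X Y p : 'rV[R]_m :=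
  normal_part p
    (md (fun q => md T q (Y q)) p (X p) - md T p (nabla X Y p)).

(* The bundle map from the normal to the tangent bundle determined by
   <Y eta, f_* v> + <eta, L v> = 0, where L = md T. *)
Definition bending_Y T p (eta : 'rV[R]_m) : 'rV[R]_n :=
  xget 0 [set w | forall v,
    dotr (md f p w) (md f p v) + dotr eta (md T p v) = 0].

Definition assoc_E (alpha : M -> 'rV[R]_n -> 'rV[R]_n -> 'rV[R]_m) T p
    (u : 'rV[R]_n) (eta : 'rV[R]_m) : 'rV[R]_m :=
  alpha p u (bending_Y T p eta)
  + normal_part p (md T p (shape_op alpha p eta u)).

Definition has_associated_pair
    (alpha : M -> 'rV[R]_n -> 'rV[R]_n -> 'rV[R]_m) T
    (beta : M -> 'rV[R]_n -> 'rV[R]_n -> 'rV[R]_m)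
    (E : M -> 'rV[R]_n -> 'rV[R]_m -> 'rV[R]_m) : Prop :=
  exists C, [/\ skew_endo C,
    forall X Y, vfield X -> vfield Y -> forall p,
      assoc_beta T X Y p =
        beta p (X p) (Y p) + C p (alpha p (X p) (Y p)) &
    forall X eta, vfield X -> normal_section eta -> forall p,
      assoc_E alpha T p (X p) (eta p) =
        E p (X p) (eta p) - covder_NN C X eta p].

End Immersion.

(* Main.v *)
(* Read the pair (beta, E) as the one-form Omega on M with values in the skew
   endomorphisms of the trivial bundle M x R^m given by
   Omega(X) f_*Y = beta(X, Y) and Omega(X) eta = - f_* B_eta X + E(X, eta).
   The three equations say exactly that d Omega = 0, so on a simply connected M
   there is a skew field D with d D = Omega.  As beta is symmetric, the form
   X |-> D f_*X is closed too, and its primitive T is an infinitesimal bending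
   whose pair is (beta, E) up to the endomorphism C = (D restricted to the
   normal bundle)^perp.  Conversely, a bending T with endomorphism C yields the
   skew field D equal to T_* on tangent vectors and to Y + C on normal ones;
   the tangential part of (dD)(X) f_*Y is symmetric in X, Y and skew in its
   values, hence vanishes, and so d D = Omega.  Two solutions thus differ by a
   constant skew endomorphism and a translation.
   As f is an immersion, every one-form on M is of the form sum_a w_a df_a, and
   the projections of constant vectors of R^m provide enough global tangent and
   normal sections; no partition of unity is needed. *)
Require Import Defs.
From HB Require Import structures.
From mathcomp Require Import all_boot all_order all_algebra.
From mathcomp Require Import all_classical all_reals all_analysis.
From mathcomp Require Import ring lra.

Set Implicit Arguments.
Unset Strict Implicit.
Unset Printing Implicit Defensive.

Import Order.TTheory GRing.Theory Num.Theory.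
Import numFieldNormedType.Exports.

Local Open Scope classical_set_scope.
Local Open Scope ring_scope.

(** * Gluing local primitives on a simply connected space *)

(** Primitives are needed twice, for the entries of D and for the components of T. The paths and
    homotopies offered by simple connectedness are merely continuous, so forms cannot be integrated
    along them directly. Primitives found on small coordinate balls, by integration along segments,
    are continued along continuous maps instead, as in a monodromy argument. The three equations
    match the blocks of d Omega: tangent-to-tangent is the first, tangent-to-normal the second,
    normal-to-normal the third; skewness determines the remaining block. In the converse direction T
    alone does not determine the normal block of its rotation field. Filling that block with the
    endomorphism C of the identification of pairs makes the derivative of the rotation field equal
    to Omega itself, so that two solutions can be compared directly. *)

Lemma continuous_pair (X Y Z : topologicalType) (f : X -> Y) (g : X -> Z) :
  continuous f -> continuous g -> continuous (fun x => (f x, g x)).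
Proof. by move=> cf cg x; exact: cvg_pair (cf x) (cg x). Qed.

Lemma continuous_paste (R : realType) (X : topologicalType) (f g : R -> X) (a : R) :
  continuous f -> continuous g -> f a = g a ->
  continuous (fun t : R => if t <= a then f t else g t).
Proof.
move=> cf cg fga; apply/continuous_subspace_setT.
have -> : [set: R] = [set t | t <= a] `|` [set t | a <= t].
  by apply/seteqP; split=> // t _ /=; have [|/ltW] := leP t a; [left|right].
apply: withinU_continuous; [exact: closed_le|exact: closed_ge| |].
  apply: (@subspace_eq_continuous _ _ _ f) (continuous_subspaceT cf) => t.
  by move=> /set_mem /= ta; rewrite /from_subspace ta.
apply: (@subspace_eq_continuous _ _ _ g) (continuous_subspaceT cg) => t.
move=> /set_mem /=; rewrite /from_subspace le_eqVlt => /predU1P[<-|]; first by rewrite lexx.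
by rewrite ltNge => /negbTE ->.
Qed.

Section Primitives.
Context {R : realType}.

(* Compactness of [0, 1] as an induction principle on its subintervals. *)
Lemma segment_ind (P : R -> R -> Prop) :
  (forall a b c, a <= b -> b <= c -> P a b -> P b c -> P a c) ->
  (forall x, exists2 d, 0 < d & forall a b, a <= b -> x - d < a -> b < x + d ->
     P a b) ->
  P 0 1.
Proof.
move=> Pcat Ploc.
pose S := [set x : R | 0 <= x <= 1 /\ P 0 x].
have S0 : S 0.
  split; first by rewrite lexx ler01.
  by have [d d0 H] := Ploc 0; apply: H => //; lra.
have supS : has_sup S by split; [exists 0|exists 1 => x [/andP[]]].
have [d d0 H] := Ploc (sup S).
have [x [/andP[x0 x1] Px] xd] := sup_adherent d0 supS.
have xs : x <= sup S by apply: (@ub_le_sup _ S) => //; [exact: supS.2|split=> //; rewrite x0].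
(* [y] lies beyond the supremum unless the supremum has reached 1; as [P 0 y] holds, only the latter
   is possible. *)
set y := Num.min 1 (sup S + d / 2).
have sy : sup S <= y.
  by rewrite le_min; apply/andP; split; [apply: ge_sup; [exists 0|move=> z [/andP[]]]|lra].
have yd : y < sup S + d by rewrite gt_min; apply/orP; right; lra.
have y1 : y <= 1 by rewrite ge_min lexx.
have Py : P 0 y by apply: (Pcat 0 x y) => //; [lra|apply: H => //; lra].
have : y <= sup S.
  by apply: (@ub_le_sup _ S) => //; [exact: supS.2|split=> //; apply/andP; split=> //; lra].
move=> ys; move: Py; have -> : y = 1; last by [].
by move: ys; rewrite {1}/y ge_min => /orP[|]; [lra|lra].
Qed.

Lemma locally_cst_connected (X : topologicalType) (V : Type) (A : set X) (h : X -> V) :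
  connected A ->
  (forall x, A x -> \forall y \near x, A y -> h y = h x) ->
  forall x y, A x -> A y -> h x = h y.
Proof.
move=> Aco hloc x y Ax Ay; apply: contrapT => hxy.
suff: ~ connected A by [].
apply/connectedPn.
exists (fun b => A `&` [set z | if b then h z = h x else h z <> h x]).
split.
- by case; [exists x|exists y; split => // /esym].
- apply/seteqP; split=> z; first by move=> Az; case: (pselect (h z = h x)); [right|left].
  by case=> -[].
split; apply/seteqP; split=> // z [].
- move=> cl [Az /= hz].
  have [w [[Aw /= hw] /(_ Aw) e]] := cl _ (hloc z Az).
  by apply: hw; rewrite e.
- move=> [Az /= nz] cl; apply: nz.
  by have [w [[Aw /= <-] /(_ Aw)]] := cl _ (hloc z Az).
Qed.

Variables (M : topologicalType) (F : M -> M -> R).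
Hypothesis F_compat : forall p, \forall q \near p,
  exists c, \forall r \near q, F p r = F q r + c.
Hypothesis M_locpath : forall p (U : set M), nbhs p U -> \forall q \near p,
  exists sigma : R -> M, [/\ continuous sigma, sigma 0 = p, sigma 1 = q &
    forall t, 0 <= t <= 1 -> U (sigma t)].

(* [F p] stands for a primitive, near p, of a closed one-form; G is then a
   primitive of its pull-back along K over A, although K need not be
   differentiable. *)
Definition prim_along (X : topologicalType) (K : X -> M) (A : set X) (G : X -> R) :=
  forall x, A x -> exists c, \forall y \near x, A y -> G y = F (K x) (K y) + c.

(** Agreement of [K'] with [K \o phi] is asked on B only: concatenated and clamped paths coincide
    with the original ones just on part of their parameter space. *)
Lemma prim_along_comp (X Y : topologicalType) (K : X -> M) (A : set X) (G : X -> R)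
    (phi : Y -> X) (B : set Y) (K' : Y -> M) :
  continuous phi -> (forall y, B y -> A (phi y)) ->
  (forall y, B y -> K' y = K (phi y)) ->
  prim_along K A G -> prim_along K' B (G \o phi).
Proof.
move=> cphi BA KK' AG x Bx; have [c Gc] := AG _ (BA _ Bx); exists c.
near=> y => By /=; rewrite !KK'//; have : A (phi y) by exact: BA.
near: y; exact: cphi Gc.
Unshelve. all: end_near. Qed.

Lemma prim_along_sub (X : topologicalType) (K : X -> M) (A B : set X) (G : X -> R) :
  B `<=` A -> prim_along K A G -> prim_along K B G.
Proof. by move=> BA; apply: (@prim_along_comp _ _ K A G id) => // x; exact: cvg_id. Qed.

Lemma prim_along_uniq (X : topologicalType) (K : X -> M) (A : set X) (G1 G2 : X -> R) x y :
  connected A -> prim_along K A G1 -> prim_along K A G2 -> A x -> A y ->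
  G1 y - G1 x = G2 y - G2 x.
Proof.
move=> cA A1 A2 Ax Ay.
have : (G1 - G2) x = (G1 - G2) y.
  apply: (locally_cst_connected cA) => // z Az.
  have [c1 H1] := A1 _ Az; have [c2 H2] := A2 _ Az.
  have := nbhs_singleton H1 Az; have := nbhs_singleton H2 Az => {}e2 e1.
  near=> w => Aw; rewrite !fctE (near H1 w)// (near H2 w)// e1 e2; lra.
rewrite !fctE; lra.
Unshelve. all: end_near. Qed.

(** On the connected overlap the two primitives differ by a constant, by which the second is
    shifted; an empty overlap allows any constant. Closedness gives a point outside one set a
    neighbourhood avoiding it, so only points of the overlap need both primitives. *)
Lemma prim_along_glue (X : topologicalType) (K : X -> M) (A B : set X) (G1 G2 : X -> R) :
  closed A -> closed B -> connected (A `&` B) ->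
  prim_along K A G1 -> prim_along K B G2 -> exists G, prim_along K (A `|` B) G.
Proof.
move=> clA clB cAB A1 B2.
have [k Hk] : exists k, forall x, A x -> B x -> G1 x = G2 x + k.
  have [[z [Az Bz]]|no] := pselect (exists z, (A `&` B) z); last first.
    by exists 0 => x Ax Bx; case: no; exists x.
  exists (G1 z - G2 z) => x Ax Bx.
  have := @prim_along_uniq _ K (A `&` B) G1 G2 z x cAB
   (prim_along_sub (@subIsetl _ _ _) A1) (prim_along_sub (@subIsetr _ _ _) B2).
  by move=> /(_ (conj Az Bz) (conj Ax Bx)); lra.
exists (fun x => if pselect (A x) then G1 x else G2 x + k) => x ABx.
have out C : closed C -> ~ C x -> \forall y \near x, ~ C y.
  by move=> clC nC; apply: open_nbhs_nbhs; split=> //; exact: closed_openC.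
have [Ax|nAx] := pselect (A x); have [Bx|nBx] := pselect (B x).
- have [c1 H1] := A1 _ Ax; have [c2 H2] := B2 _ Bx; exists c1.
  have := nbhs_singleton H1 Ax; have := nbhs_singleton H2 Bx => {}e2 e1.
  near=> y => ABy; case: pselect => [Ay|nAy]; first exact: (near H1 y).
  have By : B y by case: ABy.
  rewrite (near H2 y)//; have := Hk _ Ax Bx; move: e1 e2 => /= -> -> h; rewrite -addrA.
  by apply: congr1; apply: (addrI (F (K x) (K x))); rewrite h addrA.
- have [c1 H1] := A1 _ Ax; exists c1; have nB := out B clB nBx.
  near=> y => -[Ay|By]; last by exfalso; exact: (near nB y).
  by case: pselect => [?|//]; exact: (near H1 y).
- have [c2 H2] := B2 _ Bx; exists (c2 + k); have nA := out A clA nAx.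
  near=> y => -[Ay|By]; first by exfalso; exact: (near nA y).
  case: pselect => [Ay|?]; first by exfalso; exact: (near nA y).
  by rewrite (near H2 y)// addrA.
- by case: ABx.
Unshelve. all: end_near. Qed.

Lemma prim_along_local (X : topologicalType) (K : X -> M) (x0 : X) : continuous K ->
  exists (U : set X) (G : X -> R), nbhs x0 U /\ prim_along K U G.
Proof.
move=> cK.
exists [set y | exists c, \forall r \near K y, F (K x0) r = F (K y) r + c].
exists (F (K x0) \o K); split; first exact: cK (F_compat (K x0)).
move=> x /= [c Hc]; exists c; near=> y => _.
near: y; exact: cK Hc.
Unshelve. all: end_near. Qed.

Definition rect (a b c d : R) : set (R * R) := [set x | a <= x.1 <= b /\ c <= x.2 <= d].

Lemma closed_rect a b c d : closed (rect a b c d).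
Proof.
have -> : rect a b c d = (fst @^-1` `[a, b]) `&` (snd @^-1` `[c, d]).
  by apply/seteqP; split=> x; rewrite /rect/= !in_itv.
apply: closedI; apply: closed_comp; try exact: interval_closed; move=> x _.
exact: cvg_fst.
exact: cvg_snd.
Qed.

Lemma connected_rect_vert b c d : connected (rect b b c d).
Proof.
have -> : rect b b c d = (fun t : R => (b, t)) @` `[c, d].
  apply/seteqP; split=> [[s t]|x [t]]; rewrite /rect/= ?in_itv/=.
    by case=> sb tcd; exists t; rewrite ?in_itv//; congr (_, _); lra.
  by move=> tcd <-/=; rewrite lexx.
apply: connected_continuous_connected; first exact: segment_connected.
by apply: continuous_subspaceT; apply: continuous_pair => t; [exact: cvg_cst|exact: cvg_id].
Qed.

Lemma connected_rect_horiz a b c : connected (rect a b c c).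
Proof.
have -> : rect a b c c = (fun t : R => (t, c)) @` `[a, b].
  apply/seteqP; split=> [[s t]|x [t]]; rewrite /rect/= ?in_itv/=.
    by case=> sb tcd; exists s; rewrite ?in_itv//; congr (_, _); lra.
  by move=> tcd <-/=; rewrite lexx.
apply: connected_continuous_connected; first exact: segment_connected.
by apply: continuous_subspaceT; apply: continuous_pair => t; [exact: cvg_id|exact: cvg_cst].
Qed.

(** Two nested uses of [segment_ind] subdivide the square. The inner one glues small rectangles side
    by side into a strip of full width around height [t0], keeping the smaller of two heights at
    each step; the outer one stacks such strips. *)
Lemma prim_along_square (H : R * R -> M) : continuous H ->
  exists G, prim_along H (rect 0 1 0 1) G.
Proof.
move=> cH; pose good a b c d := exists G, prim_along H (rect a b c d) G.
have goodS a b c d a' b' c' d' : a <= a' -> b' <= b -> c <= c' -> d' <= d ->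
    good a b c d -> good a' b' c' d'.
  move=> aa bb cc dd [G HG]; exists G; apply: prim_along_sub HG => x.
  by rewrite /rect/=; lra.
apply: (segment_ind (P := fun c d => good 0 1 c d)) => [c d e cd de [G1 H1] [G2 H2]|t0].
  have [] := prim_along_glue (@closed_rect 0 1 c d) (@closed_rect 0 1 d e) _ H1 H2.
    have -> : rect 0 1 c d `&` rect 0 1 d e = rect 0 1 d d.
      by apply/seteqP; split=> x; rewrite /rect/=; lra.
    exact: connected_rect_horiz.
  move=> G HG; exists G; apply: prim_along_sub HG => x; rewrite /rect/= => -[x1 x2].
  by have [|] := leP x.2 d => ?; [left|right]; lra.
suff [d d0 gd] : exists2 d, 0 < d & good 0 1 (t0 - d) (t0 + d).
  by exists d => // a b ab a1 b1; apply: goodS gd; lra.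
apply: (segment_ind (P := fun a b => exists2 d, 0 < d & good a b (t0 - d) (t0 + d))).
  move=> a b e ab be [d1 d10 g1] [d2 d20 g2].
  set d := Num.min d1 d2.
  have d0 : 0 < d by rewrite lt_min d10.
  have dd1 : d <= d1 by rewrite ge_min lexx.
  have dd2 : d <= d2 by rewrite ge_min lexx orbT.
  have [G1 H1] : good a b (t0 - d) (t0 + d) by apply: goodS g1; lra.
  have [G2 H2] : good b e (t0 - d) (t0 + d) by apply: goodS g2; lra.
  exists d => //.
  have [] := prim_along_glue (@closed_rect _ _ _ _) (@closed_rect _ _ _ _) _ H1 H2.
    rewrite (_ : _ `&` _ = rect b b (t0 - d) (t0 + d)); first exact: connected_rect_vert.
    by apply/seteqP; split=> x; rewrite /rect/=; lra.
  move=> G HG; exists G; apply: prim_along_sub HG => x; rewrite /rect/= => -[x1 x2].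
  by have [|] := leP x.1 b => ?; [left|right]; lra.
move=> s0; have [U [G [nU HG]]] := prim_along_local (s0, t0) cH.
have [d /= d0 dU] := (nbhs_ballP _ _).1 nU.
exists (d / 2); first lra.
move=> a b ab a1 b1; exists (d / 2); first lra.
exists G; apply: prim_along_sub HG => -[s t]; rewrite /rect/= => -[st1 st2].
by apply: dU; split; rewrite /ball/= ltr_norml; lra.
Qed.

Lemma within_continuous_comp (X Y Z : topologicalType) (A : set Y) (K : Y -> Z) (phi : X -> Y) :
  {within A, continuous K} -> continuous phi -> (forall x, A (phi x)) ->
  continuous (K \o phi).
Proof.
move=> /subspace_continuousP cK cphi Aphi x.
apply: (@cvg_comp _ _ _ phi K (nbhs x) (within A (nbhs (phi x)))); last exact: cK.
move=> B /= nB; have := cphi x _ nB; rewrite /nbhs/= => h.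
by near=> y; apply: (near h y) => //; exact: Aphi.
Unshelve. all: end_near. Qed.

(** Precomposition with this retraction makes a map that is continuous only within [0, 1] continuous
    everywhere, without changing it on [0, 1]. *)
Definition clamp (t : R) : R := Num.max 0 (Num.min 1 t).

Lemma continuous_clamp : continuous clamp.
Proof.
move=> t; apply: (@continuous_max _ R^o); first exact: cvg_cst.
by apply: (@continuous_min _ R^o); [exact: cvg_cst|exact: cvg_id].
Qed.

Lemma clamp_itv t : 0 <= clamp t <= 1.
Proof. by rewrite le_max lexx ge_max ler01 ge_min lexx. Qed.

Lemma clamp_id t : 0 <= t <= 1 -> clamp t = t.
Proof. by move=> /andP[t0 t1]; rewrite /clamp min_r// max_r. Qed.

Let I01 : set R := [set t | 0 <= t <= 1].

(* v is the integral of the one-form along some path from p to q. *)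
Definition link (p q : M) (v : R) := exists (gamma : R -> M) (G : R -> R),
  [/\ continuous gamma, gamma 0 = p, gamma 1 = q, prim_along gamma I01 G & v = G 1 - G 0].

Lemma connected_I (a b : R) : connected [set t : R | a <= t <= b].
Proof.
have -> : [set t | a <= t <= b] = `[a, b]%classic by apply/seteqP; split=> x /=; rewrite in_itv.
exact: segment_connected.
Qed.

(** The square case for [gamma \o fst], restricted to the bottom side. *)
Lemma prim_along_path (gamma : R -> M) : continuous gamma -> exists G, prim_along gamma I01 G.
Proof.
move=> cg; have [G HG] : exists G, prim_along (gamma \o fst) (rect 0 1 0 1) G.
  apply: prim_along_square => x; apply: cvg_comp; [exact: cvg_fst|exact: cg].
exists (G \o (fun t : R => (t, 0))); apply: prim_along_comp HG => //.
  apply: continuous_pair => t; [exact: cvg_id|exact: cvg_cst].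
by move=> t; rewrite /I01/rect/=; lra.
Qed.

Lemma link_rev p q v : link p q v -> link q p (- v).
Proof.
move=> [gam [G [cg g0 g1 HG ->]]].
have c1 : continuous (fun t : R => 1 - t).
  by move=> t; apply: cvgB; [exact: cvg_cst|exact: cvg_id].
exists (gam \o (fun t : R => 1 - t)), (G \o (fun t : R => 1 - t)); split=> //=.
- by move=> t; apply: cvg_comp; [exact: c1|exact: cg].
- by rewrite subr0.
- by rewrite subrr.
- by apply: prim_along_comp HG => // t; rewrite /I01/=; lra.
- by rewrite subrr subr0 opprB.
Qed.

Lemma link_cat p q r v w : link p q v -> link q r w -> link p r (v + w).
Proof.
move=> [g [G [cg g0 g1 HG ->]]] [h [H [ch h0 h1 HH ->]]].
pose gh (t : R) := if t <= 1 / 2 then g (clamp (2 * t)) else h (clamp (2 * t - 1)).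
have cl1 : continuous (fun t : R => clamp (2 * t)).
  move=> t; apply: (@cvg_comp _ _ _ (fun t : R => 2 * t) clamp).
    by apply: cvgM; [exact: cvg_cst|exact: cvg_id].
  exact: continuous_clamp.
have cl2 : continuous (fun t : R => clamp (2 * t - 1)).
  move=> t; apply: (@cvg_comp _ _ _ (fun t : R => 2 * t - 1) clamp).
    by apply: cvgB; [apply: cvgM; [exact: cvg_cst|exact: cvg_id]|exact: cvg_cst].
  exact: continuous_clamp.
have gE t : t <= 1 / 2 -> gh t = g (clamp (2 * t)) by move=> tl; rewrite /gh tl.
have hE t : 1 / 2 <= t -> gh t = h (clamp (2 * t - 1)).
  rewrite le_eqVlt => /orP[/eqP <-|t2].
    rewrite gE; last exact: lexx.
    rewrite (_ : 2 * (1 / 2) = 1); last lra.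
    by rewrite subrr !clamp_id ?g1 ?h0//; lra.
  by rewrite /gh leNgt t2.
have cgh : continuous gh.
  apply: (@continuous_paste _ _ (fun t => g (clamp (2 * t))) (fun t => h (clamp (2 * t - 1)))).
  - by move=> t; apply: (@cvg_comp _ _ _ _ g); [exact: cl1|exact: cg].
  - by move=> t; apply: (@cvg_comp _ _ _ _ h); [exact: cl2|exact: ch].
  - by rewrite -gE ?hE// lexx.
have gh0 : gh 0 = p by rewrite gE ?mulr0 ?clamp_id ?g0//; lra.
have gh1 : gh 1 = r.
  rewrite hE; last lra.
  rewrite (_ : 2 * 1 - 1 = 1); last lra.
  by rewrite clamp_id//; lra.
(* A fresh primitive along the concatenation is compared with the given ones on each half by
   uniqueness up to constants, which spares gluing them. *)
have [K HK] := prim_along_path cgh.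
exists gh, K; split=> //.
pose A : set R := [set t | 0 <= t <= 1 / 2]; pose B : set R := [set t | 1 / 2 <= t <= 1].
have PA : prim_along gh A (G \o (fun t : R => clamp (2 * t))).
  apply: prim_along_comp HG => // t At; first exact: clamp_itv.
  by rewrite gE//; move: At; rewrite /A/=; lra.
have PB : prim_along gh B (H \o (fun t : R => clamp (2 * t - 1))).
  apply: prim_along_comp HH => // t Bt; first exact: clamp_itv.
  by rewrite hE//; move: Bt; rewrite /B/=; lra.
have KA : prim_along gh A K by apply: prim_along_sub HK => t; rewrite /A/I01/=; lra.
have KB : prim_along gh B K by apply: prim_along_sub HK => t; rewrite /B/I01/=; lra.
have A0 : A 0 by rewrite /A/=; lra.
have Ah : A (1/2) by rewrite /A/=; lra.
have Bh : B (1/2) by rewrite /B/=; lra.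
have B1 : B 1 by rewrite /B/=; lra.
have := prim_along_uniq (@connected_I _ _) KA PA A0 Ah.
have := prim_along_uniq (@connected_I _ _) KB PB Bh B1.
rewrite /= !clamp_id; try lra.
rewrite (_ : 2 * (1/2) = 1); last lra.
rewrite (_ : 2 * 1 - 1 = 1); last lra.
rewrite (_ : 2 * 0 = 0); last lra.
rewrite subrr; lra.
Qed.

Lemma link_local p : \forall q \near p, link p q (F p q - F p p).
Proof.
have := @M_locpath p _ (F_compat p); apply: filterS => q [s [cs s0 s1 Us]].
exists s, (F p \o s); split=> //; last by rewrite /= s0 s1.
move=> t It; have [c Hc] := Us t It; exists c.
near=> t' => It'; near: t'; exact: cs Hc.
Unshelve. all: end_near. Qed.

(* G, a primitive along a contraction of the loop to its base point, is constant
   on three sides of the square, hence takes equal values at the ends of the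
   fourth. *)
Lemma link_loop (M_sc : simply_connected R M) p v : link p p v -> v = 0.
Proof.
move=> [g [G [cg g0 g1 HG ->]]]; have [_ _ loops] := M_sc.
have [H [cH H0 H1 Hs]] := loops g (continuous_subspaceT cg) (etrans g0 (esym g1)).
pose c2 (x : R * R) := (clamp x.1, clamp x.2).
have cc2 : continuous c2.
  apply: continuous_pair => x.
    by apply: (@cvg_comp _ _ _ fst clamp); [exact: cvg_fst|exact: continuous_clamp].
  by apply: (@cvg_comp _ _ _ snd clamp); [exact: cvg_snd|exact: continuous_clamp].
have cHc : continuous (H \o c2).
  apply: (within_continuous_comp cH cc2) => x.
  by split; rewrite /= in_itv/= clamp_itv.
have [K HK] := prim_along_square cHc.
have cst_side (phi : R -> R * R) : continuous phi ->
    (forall t, 0 <= t <= 1 -> rect 0 1 0 1 (phi t) /\ H (phi t) = p) ->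
    K (phi 0) = K (phi 1).
  move=> cphi Hphi.
  have P1 : prim_along (cst p) I01 (K \o phi).
    apply: prim_along_comp HK => // t /Hphi[rt Ht] //=.
    rewrite /c2 !clamp_id; [|by case: rt..].
    by rewrite -surjective_pairing.
  have loc x : I01 x -> \forall y \near x, I01 y -> (K \o phi) y = (K \o phi) x.
    move=> Ix; have [c Hc] := P1 x Ix.
    near=> y => Iy; have -> := nbhs_singleton Hc Ix; exact: (near Hc y).
  by apply: (locally_cst_connected (@connected_I 0 1) loc) => /=; rewrite lexx ler01.
have c_t0 (a : R) : continuous (fun t : R => (t, a)).
  by apply: continuous_pair => t; [exact: cvg_id|exact: cvg_cst].
have c_1t (a : R) : continuous (fun t : R => (a, t)).
  by apply: continuous_pair => t; [exact: cvg_cst|exact: cvg_id].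
have e1 : K (0, 0) = K (1, 0).
  apply: (cst_side (fun t => (t, 0))) => // t It; split; first by rewrite /rect/=; lra.
  by rewrite (Hs t _).1 ?g0// in_itv.
have e2 : K (1, 0) = K (1, 1).
  apply: (cst_side (fun t => (1, t))) => // t It; split; first by rewrite /rect/=; lra.
  by rewrite H1 ?g0// in_itv.
have e3 : K (0, 1) = K (1, 1).
  apply: (cst_side (fun t => (t, 1))) => // t It; split; first by rewrite /rect/=; lra.
  by rewrite (Hs t _).2 ?g0// in_itv.
have P0 : prim_along g I01 (K \o (fun t : R => (0 : R, t))).
  apply: prim_along_comp HK => // t It; first by rewrite /rect/=; move: It; rewrite /I01/=; lra.
  by rewrite /= /c2/= !clamp_id//; [rewrite H0// in_itv|lra].
have I0 : I01 0 by rewrite /I01/= lexx ler01.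
have I1 : I01 1 by rewrite /I01/= lexx ler01.
have := prim_along_uniq (@connected_I 0 1) HG P0 I0 I1.
rewrite /= => ->; lra.
Unshelve. all: end_near. Qed.

(** For each q some path from a base point [p0] is chosen and [G q] is the integral along it. The
    choice is immaterial: the loop from [p0] to p, on to a nearby q and back to [p0] has integral
    zero. *)
Lemma simply_connected_glue (M_sc : simply_connected R M) :
  exists G : M -> R, forall p, \forall q \near p, G q = F p q + (G p - F p p).
Proof.
have [[p0 _] pc _] := M_sc.
have ex q : exists v, link p0 q v.
  have [g [cg g0 g1]] := pc p0 q.
  have cgc : continuous (g \o clamp).
    apply: (within_continuous_comp cg continuous_clamp) => x.
    by rewrite /= in_itv/= clamp_itv.
  have [G HG] := prim_along_path cgc.
  exists (G 1 - G 0), (g \o clamp), G; split=> //=; rewrite clamp_id//; lra.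
have [G HG] := choice ex.
exists G => p; near=> q.
have l1 : link p q (F p q - F p p) by near: q; exact: link_local.
have := link_loop M_sc (link_cat (link_cat (HG p) l1) (link_rev (HG q))).
lra.
Unshelve. all: end_near. Qed.

End Primitives.

(** * Calculus of smooth maps *)

Section Ck_calculus.
Context {R : realType}.

Lemma near_eq_differentiable (V W : normedModType R) (f g : V -> W) (x : V) :
  (\near x, f x = g x) -> differentiable f x -> differentiable g x.
Proof.
move=> fg df.
have fgx : f x = g x := nbhs_singleton fg.
have [cdf fE] := (diff_locallyP _ _).1 df.
have gE : g \o shift x = cst (g x) + 'd f x +o_ (0 : V) id.
  apply/eqaddoP => e e0.
  have : \forall h \near (0 : V), f (h + x) = g (h + x).
    have : (fun h : V => h + x) @ (0 : V) --> x.
      by rewrite -[X in _ --> X]add0r; apply: cvgD; [exact: cvg_id|exact: cvg_cst].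
    by move/(_ _ fg).
  have /eqaddoP/(_ e e0) : f \o shift x = cst (f x) + 'd f x +o_ (0 : V) id.
    exact: diff_locally.
  apply: filterS2 => h /[swap] fgh; congr (`| _ | <= _).
  by rewrite !fctE /= -fgx fgh.
have dg := diff_unique cdf gE.
by apply/diff_locallyP; rewrite dg.
Qed.

Lemma derive_linear_comp (V W U : normedModType R) (f : V -> W) (l : W -> U) x v :
  linear l -> continuous l -> differentiable f x ->
  differentiable (l \o f) x /\ 'D_v (l \o f) x = l ('D_v f x).
Proof.
move=> ll cl df.
pose lM := GRing.isLinear.Build _ _ _ _ _ ll.
pose L : {linear W -> U} := HB.pack l lM.
have cL : continuous L := cl.
have dL y : differentiable L y by exact: linear_differentiable.
split; first exact: (@differentiable_comp _ _ _ _ f L).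
rewrite !deriveE//; last exact: (@differentiable_comp _ _ _ _ f L).
have -> : 'd (l \o f) x = 'd L (f x) \o 'd f x :> (V -> U).
  exact: (@diff_comp _ _ _ _ f L).
by rewrite /= (@diff_lin _ _ _ L).
Qed.


Lemma Ck_eq n (V : normedModType R) (U : set 'rV[R]_n) (F G : 'rV[R]_n -> V) k :
  open U -> (forall x, U x -> F x = G x) -> Ck k U F -> Ck k U G.
Proof.
move=> oU; elim: k F G => [|k IH] F G FG /=.
  move=> cF x Ux; have nFG : \forall y \near x, F y = G y.
    by have := open_nbhs_nbhs (conj oU Ux); apply: filterS => y /FG ->.
  have : F @ x --> F x := cF x Ux.
  by rewrite (FG x Ux) => cFx; apply: cvg_trans cFx; exact: (near_eq_cvg nFG).
have nFG x : U x -> \forall y \near x, F y = G y.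
  by move=> Ux; have := open_nbhs_nbhs (conj oU Ux); apply: filterS => y /FG ->.
move=> [dF cF]; split=> [x Ux|v]; first exact: near_eq_differentiable (nFG _ Ux) (dF _ Ux).
by apply: IH (cF v) => x Ux; apply: near_eq_derive; exact: nFG.
Qed.

Lemma CkW n (V : normedModType R) (U : set 'rV[R]_n) (F : 'rV[R]_n -> V) k :
  Ck k.+1 U F -> Ck k U F.
Proof.
elim: k F => [|k IH] F [dF cF]; first by move=> x Ux; exact: differentiable_continuous (dF x Ux).
by split=> // v; apply: IH; exact: cF.
Qed.

Lemma Ck_cst n (V : normedModType R) (U : set 'rV[R]_n) (a : V) k : Ck k U (cst a).
Proof.
elim: k a => [|k IH] a; first by move=> x _; exact: (@cst_continuous _ _ a x).
split=> [x _|v]; first exact: differentiable_cst.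
by rewrite (_ : (fun x => _) = cst 0); [exact: IH|apply/funext => x; exact: derive_cst].
Qed.

Section open_set.
Context {n : nat} {U : set 'rV[R]_n}.
Hypothesis oU : open U.

Lemma CkD (V : normedModType R) (F G : 'rV[R]_n -> V) k :
  Ck k U F -> Ck k U G -> Ck k U (F + G).
Proof.
elim: k F G => [|k IH] F G; first by move=> cF cG x Ux; apply: continuousD; [exact: cF|exact: cG].
move=> [dF cF] [dG cG]; split=> [x Ux|v]; first by apply: differentiableD; [exact: dF|exact: dG].
apply: (Ck_eq oU _ (IH _ _ (cF v) (cG v))) => x Ux.
by rewrite deriveD//; apply: diff_derivable; [exact: dF|exact: dG].
Qed.

Lemma Ck_linear (V W : normedModType R) (F : 'rV[R]_n -> V) (l : V -> W) k :
  linear l -> continuous l -> Ck k U F -> Ck k U (l \o F).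
Proof.
move=> ll cl; elim: k F => [|k IH] F.
  by move=> cF x Ux; apply: continuous_comp; [exact: cF|exact: cl].
move=> [dF cF]; split=> [x Ux|v]; first by case: (derive_linear_comp 0 ll cl (dF x Ux)).
apply: (Ck_eq oU _ (IH _ (cF v))) => x Ux.
by case: (derive_linear_comp v ll cl (dF x Ux)) => _ ->.
Qed.

Lemma CkM (F G : 'rV[R]_n -> R) k : Ck k U F -> Ck k U G -> Ck k U (F * G).
Proof.
elim: k F G => [|k IH] F G; first by move=> cF cG x Ux; apply: continuousM; [exact: cF|exact: cG].
move=> FS GS; have [dF cF] := FS; have [dG cG] := GS.
split=> [x Ux|v]; first by apply: differentiableM; [exact: dF|exact: dG].
apply: (Ck_eq oU _ (CkD (IH _ _ (CkW FS) (cG v)) (IH _ _ (CkW GS) (cF v)))) => x Ux.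
by rewrite deriveM//; apply: diff_derivable; [exact: dF|exact: dG].
Qed.

Lemma CkN (F : 'rV[R]_n -> R) k : Ck k U F -> Ck k U (- F).
Proof.
move=> CF; have := CkM (Ck_cst U (-1 : R) k) CF; apply: Ck_eq => // x _.
by rewrite !fctE mulN1r.
Qed.

Lemma CkV (F : 'rV[R]_n -> R) k : (forall x, U x -> F x != 0) ->
  Ck k U F -> Ck k U (fun x => (F x)^-1).
Proof.
move=> F0; elim: k => [|k IH]; first by move=> cF x Ux; apply: continuousV; [exact: F0|exact: cF].
move=> FS; have [dF cF] := FS; split=> [x Ux|v].
  by apply: differentiableV; [exact: dF|exact: F0].
have CV := IH (CkW FS).
apply: (Ck_eq oU _ (CkN (CkM (CkM CV CV) (cF v)))) => x Ux.
rewrite (deriveV (F0 _ Ux) (diff_derivable (v:=v) (dF _ Ux))) !fctE.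
by rewrite -exprVn expr2 scaleNr.
Qed.

Lemma smoothD (V : normedModType R) (F G : 'rV[R]_n -> V) :
  smooth_on U F -> smooth_on U G -> smooth_on U (fun x => F x + G x).
Proof. by move=> sF sG k; apply: CkD. Qed.

Lemma smoothM (F G : 'rV[R]_n -> R) :
  smooth_on U F -> smooth_on U G -> smooth_on U (fun x => F x * G x).
Proof. by move=> sF sG k; apply: CkM. Qed.

Lemma smooth_cst (V : normedModType R) (a : V) : smooth_on U (fun=> a).
Proof. by move=> k; apply: Ck_cst. Qed.

Lemma smooth_linear (V W : normedModType R) (F : 'rV[R]_n -> V) (l : V -> W) :
  linear l -> continuous l -> smooth_on U F -> smooth_on U (fun x => l (F x)).
Proof. by move=> ll cl sF k; apply: Ck_linear. Qed.

Lemma smooth_on_eq (V : normedModType R) (F G : 'rV[R]_n -> V) :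
  (forall x, U x -> F x = G x) -> smooth_on U F -> smooth_on U G.
Proof. by move=> FG sF k; apply: Ck_eq oU FG (sF k). Qed.

Lemma smooth_sum (V : normedModType R) (I : Type) (r : seq I) (P : pred I)
    (F : I -> 'rV[R]_n -> V) :
  (forall i, P i -> smooth_on U (F i)) ->
  smooth_on U (fun x => \sum_(i <- r | P i) F i x).
Proof.
move=> sF; elim: r => [|i r IH].
  by apply: smooth_on_eq (@smooth_cst V 0) => x _; rewrite big_nil.
have [Pi|nPi] := boolP (P i).
  by apply: smooth_on_eq (smoothD (sF _ Pi) IH) => x _; rewrite big_cons Pi.
by apply: smooth_on_eq IH => x _; rewrite big_cons (negbTE nPi).
Qed.

Lemma smooth_prod (I : Type) (r : seq I) (F : I -> 'rV[R]_n -> R) :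
  (forall i, smooth_on U (F i)) -> smooth_on U (fun x => \prod_(i <- r) F i x).
Proof.
move=> sF; elim: r => [|i r IH].
  by apply: smooth_on_eq (@smooth_cst R 1) => x _; rewrite big_nil.
by apply: smooth_on_eq (smoothM (sF i) IH) => x _; rewrite big_cons.
Qed.

Lemma smooth_onV (F : 'rV[R]_n -> R) : (forall x, U x -> F x != 0) ->
  smooth_on U F -> smooth_on U (fun x => (F x)^-1).
Proof. by move=> F0 sF k; apply: CkV. Qed.

Lemma smooth_diff (V : normedModType R) (F : 'rV[R]_n -> V) x :
  smooth_on U F -> U x -> differentiable F x.
Proof. by move=> /(_ 1)[dF _] /dF. Qed.

Lemma smooth_derive (V : normedModType R) (F : 'rV[R]_n -> V) v :
  smooth_on U F -> smooth_on U (fun x => 'D_v F x).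
Proof. by move=> sF k; have [_ /(_ v)] := sF k.+1. Qed.

Lemma smooth_mxP a b (F : 'rV[R]_n -> 'M[R]_(a, b)) :
  smooth_on U F <-> forall i j, smooth_on U (fun x => F x i j).
Proof.
split=> [sF i j|sF].
  apply: (smooth_linear (l := fun A : 'M[R]_(a, b) => A i j)) sF => [k A B|].
    by rewrite !mxE.
  exact: coord_continuous.
have sd i j : smooth_on U (fun x => F x i j *: (delta_mx i j : 'M[R]_(a, b))).
  apply: (smooth_linear (l := fun r : R => r *: (delta_mx i j : 'M[R]_(a, b)))) (sF i j).
    by move=> k r s; rewrite scalerDl scalerA.
  exact: scalel_continuous.
have := smooth_sum (index_enum _) (P := xpredT)
  (fun i _ => smooth_sum (index_enum _) (P := xpredT) (fun j _ => sd i j)).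
by apply: smooth_on_eq => x _; rewrite -matrix_sum_delta.
Qed.

Lemma smooth_mulmx a b c (F : 'rV[R]_n -> 'M[R]_(a, b)) (G : 'rV[R]_n -> 'M[R]_(b, c)) :
  smooth_on U F -> smooth_on U G -> smooth_on U (fun x => F x *m G x).
Proof.
move=> /smooth_mxP sF /smooth_mxP sG; apply/smooth_mxP => i j.
have := smooth_sum (index_enum _) (P := xpredT) (fun k _ => smoothM (sF i k) (sG k j)).
by apply: smooth_on_eq => x _; rewrite mxE.
Qed.

Lemma smooth_det a (F : 'rV[R]_n -> 'M[R]_a) :
  smooth_on U F -> smooth_on U (fun x => \det (F x)).
Proof.
move=> /smooth_mxP sF; rewrite /determinant; apply: smooth_sum => s _.
by apply: smoothM; [exact: smooth_cst|apply: smooth_prod => i; exact: sF].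
Qed.

Lemma smooth_trmx a b (F : 'rV[R]_n -> 'M[R]_(a, b)) :
  smooth_on U F -> smooth_on U (fun x => (F x)^T).
Proof.
move=> /smooth_mxP sF; apply/smooth_mxP => i j.
by apply: smooth_on_eq (sF j i) => x _; rewrite mxE.
Qed.

(** Cramer's rule: the entries are cofactors divided by the determinant. *)
Lemma smooth_invmx a (F : 'rV[R]_n -> 'M[R]_a) : (forall x, U x -> F x \in unitmx) ->
  smooth_on U F -> smooth_on U (fun x => invmx (F x)).
Proof.
move=> uF sF; have sF' := (smooth_mxP _).1 sF; apply/smooth_mxP => i j.
have sc : smooth_on U (fun x => cofactor (F x) j i).
  apply: smoothM; first exact: smooth_cst.
  apply: smooth_det; apply/smooth_mxP => i' j'.
  by apply: smooth_on_eq (sF' (lift j i') (lift i j')) => x _; rewrite !mxE.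
have sd : smooth_on U (fun x => (\det (F x))^-1).
  apply: smooth_onV (smooth_det sF) => x /uF; by rewrite unitmxE unitfE.
by apply: smooth_on_eq (smoothM sd sc) => x Ux; rewrite /invmx uF// !mxE.
Qed.

End open_set.
End Ck_calculus.

(** * The Poincare lemma on a ball *)

Section Poincare.
Context {R : realType}.

Lemma cvg_sumr (T I : Type) (F : set_system T) {FF : Filter F}
    (r : seq I) (f : I -> T -> R) (l : I -> R) :
  (forall i, f i x @[x --> F] --> l i) ->
  \sum_(i <- r) f i x @[x --> F] --> \sum_(i <- r) l i.
Proof.
move=> fl; elim: r => [|i r IH].
  by under eq_fun do rewrite big_nil; rewrite big_nil; exact: cvg_cst.
by under eq_fun do rewrite big_cons; rewrite big_cons; apply: cvgD; [exact: fl|exact: IH].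
Qed.

Lemma continuous_sum_dist (T : topologicalType) k (F : 'I_k -> T -> R) (x : T) (e : R) :
  (forall i, {for x, continuous (F i)}) -> 0 < e ->
  \forall y \near x, \sum_i `|F i y - F i x| < e.
Proof.
move=> cF e0.
have cd i : `|F i y - F i x| @[y --> x] --> (0 : R).
  apply/cvgrPdist_lt => d d0; move/cvgrPdist_lt : (cF i) => /(_ _ d0).
  by apply: filterS => y; rewrite sub0r normrN normr_id distrC.
have : \sum_i `|F i y - F i x| @[y --> x] --> (0 : R).
  have := cvg_sumr (r := index_enum 'I_k) cd.
  by have -> : \sum_(i < k) (0 : R) = 0 by [rewrite big1]; exact.
move/cvgrPdist_lt => /(_ _ e0); apply: filterS => y.
by rewrite sub0r normrN; apply: le_lt_trans; exact: ler_norm.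
Qed.

Lemma is_derive_line (V W : normedModType R) (F : V -> W) (a b : V) (s : R) (l : W) :
  is_derive (a + s *: b) b F l -> is_derive s 1 (fun s : R => F (a + s *: b)) l.
Proof.
move=> [dF dFl].
have E : (fun h : R => h^-1 *: (((fun s : R => F (a + s *: b)) \o shift s) (h *: 1)
     - F (a + s *: b))) = (fun h : R => h^-1 *: ((F \o shift (a + s *: b)) (h *: b) - F (a + s *: b))).
  apply/funext => h /=; congr (_ *: (F _ - _)).
  by rewrite [_%:A]mulr1 scalerDl addrCA.
by split; rewrite /derivable/derive E.
Qed.

Lemma derive_rV n (F : 'rV[R]_n -> R) x v : differentiable F x ->
  'D_v F x = \sum_i v 0 i * 'D_(delta_mx 0 i) F x.
Proof.
move=> dF; rewrite deriveE// {1}(row_sum_delta v) linear_sum.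
by apply: eq_bigr => i _; rewrite linearZ deriveE.
Qed.

Lemma differentiable_o (V W : normedModType R) (f df : V -> W) x :
  linear df -> continuous df ->
  (forall e, 0 < e -> \forall h \near (0 : V), `|f (h + x) - f x - df h| <= e * `|h|) ->
  differentiable f x /\ forall v, 'D_v f x = df v.
Proof.
move=> ldf cdf dfo.
pose lM := GRing.isLinear.Build _ _ _ _ _ ldf.
pose L : {linear V -> W} := HB.pack df lM.
have fE : f \o shift x = cst (f x) + L +o_ (0 : V) id.
  apply/eqaddoP => e e0; apply: filterS (dfo e e0) => h.
  by rewrite !fctE /= opprD addrA.
have dE := @diff_unique _ _ _ f L x cdf fE.
have df_x : differentiable f x by apply/diff_locallyP; rewrite dE.
by split=> // v; rewrite deriveE// dE.
Qed.

Variables (n : nat) (U : set 'rV[R]_n) (L : 'I_n -> 'rV[R]_n -> R).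
Hypothesis sL : forall i, smooth_on U (L i).
Hypothesis closedL : forall i j x, U x ->
  'D_(delta_mx 0 i) (L j) x = 'D_(delta_mx 0 j) (L i) x.
Variables (y0 : 'rV[R]_n) (r : R).
Hypothesis ballU : ball y0 r `<=` U.

Let w (x v : 'rV[R]_n) : R := \sum_i v 0 i * L i x.
(** The radial primitive: the integral of the form along the segment from [y0] to x. *)
Let phi (x : 'rV[R]_n) : R :=
  \int[lebesgue_measure]_(t in `[0, 1]) w (y0 + t *: (x - y0)) (x - y0).

Let ball_seg (x : 'rV[R]_n) (t : R) : ball y0 r x -> 0 <= t <= 1 -> ball y0 r (y0 + t *: (x - y0)).
Proof.
rewrite -ball_normE /= => xb /andP[t0 t1].
rewrite opprD addrA subrr sub0r normrN normrZ ger0_norm// distrC.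
by apply: le_lt_trans xb; rewrite ler_piMl.
Qed.

Let closed_derive x (u v : 'rV[R]_n) : U x ->
  \sum_i u 0 i * 'D_v (L i) x = \sum_i v 0 i * 'D_u (L i) x.
Proof.
move=> Ux; have dL i : differentiable (L i) x := smooth_diff (sL i) Ux.
transitivity (\sum_i \sum_j u 0 i * (v 0 j * 'D_(delta_mx 0 j) (L i) x)).
  by apply: eq_bigr => i _; rewrite derive_rV// mulr_sumr.
rewrite exchange_big /=; apply: eq_bigr => j _.
rewrite derive_rV// mulr_sumr; apply: eq_bigr => i _.
by rewrite (closedL i j Ux); ring.
Qed.

Let w_line_derive (a b c d : 'rV[R]_n) (s : R) : U (a + s *: b) ->
  is_derive s 1 (fun s : R => w (a + s *: b) (c + s *: d))
   (w (a + s *: b) d + \sum_i (c + s *: d) 0 i * 'D_b (L i) (a + s *: b)).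
Proof.
move=> Us.
have H i : is_derive s 1 (fun s : R => (c + s *: d) 0 i * L i (a + s *: b))
    (d 0 i * L i (a + s *: b) + (c + s *: d) 0 i * 'D_b (L i) (a + s *: b)).
  have H1 : is_derive s 1 (fun s : R => (c + s *: d) 0 i) (d 0 i).
    have -> : (fun s : R => (c + s *: d) 0 i) = (cst (c 0 i) + id * cst (d 0 i)).
      by apply/funext => t; rewrite !fctE !mxE.
    apply: is_derive_eq; rewrite scaler0 /= add0r add0r.
    by rewrite [_%:A]mulr1.
  have H2 := is_derive_line (derivableP (diff_derivable (v := b) (smooth_diff (sL i) Us))).
  by apply: (is_derive_eq (is_deriveM H1 H2)); rewrite addrC [d 0 i * _]mulrC.
have := is_derive_sum (fun i => H i).
rewrite /w big_split /=; congr is_derive.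
by apply/funext => t; rewrite fct_sumE.
Qed.

Let cont_seg (x v : 'rV[R]_n) : ball y0 r x ->
  {within `[0 : R, 1], continuous (fun t : R => w (y0 + t *: (x - y0)) v)}.
Proof.
move=> xb; apply: derivable_within_continuous => t; rewrite in_itv /= => t01.
have Ut : U (y0 + t *: (x - y0)) by apply: ballU; exact: ball_seg.
have := @w_line_derive y0 (x - y0) v 0 t Ut.
by under eq_fun do rewrite scaler0 addr0; case.
Qed.

(* At z = (s, t), the derivative in s of the integrand of [phi (x + s *: h)]; as
   the form is closed, this is also the derivative in t of
   t * w (y0 + t *: (x + s *: h - y0)) h. *)
Let q (x h : 'rV[R]_n) (z : R * R) := w (y0 + z.2 *: (x + z.1 *: h - y0)) h +
   z.2 * \sum_i (x + z.1 *: h - y0) 0 i * 'D_h (L i) (y0 + z.2 *: (x + z.1 *: h - y0)).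

Let cont_q (x h : 'rV[R]_n) z : ball y0 r (x + z.1 *: h) -> 0 <= z.2 <= 1 ->
  {for z, continuous (q x h)}.
Proof.
move=> z1 z2.
have c1 : {for z, continuous (fun z : R * R => x + z.1 *: h - y0)}.
  apply: cvgB; last exact: cvg_cst.
  apply: cvgD; first exact: cvg_cst.
  by apply: cvgZr_tmp; exact: cvg_fst.
have cp : {for z, continuous (fun z : R * R => y0 + z.2 *: (x + z.1 *: h - y0))}.
  apply: cvgD; first exact: cvg_cst.
  by apply: cvgZ; [exact: cvg_snd|exact: c1].
have Up : U (y0 + z.2 *: (x + z.1 *: h - y0)) by apply: ballU; exact: ball_seg.
have cLp F : smooth_on U F ->
    {for z, continuous (fun z : R * R => F (y0 + z.2 *: (x + z.1 *: h - y0)) : R)}.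
  move=> sF; apply: (@continuous_comp _ _ _ _ F) => //.
  exact: differentiable_continuous (smooth_diff sF Up).
apply: cvgD.
  rewrite /w; apply: cvg_sumr => i.
  by apply: cvgM; [exact: cvg_cst|exact: (cLp _ (sL i))].
apply: cvgM; first exact: cvg_snd.
apply: cvg_sumr => i; apply: cvgM; last exact: (cLp _ (smooth_derive h (sL i))).
apply: (@cvg_comp _ _ _ (fun z : R * R => x + z.1 *: h - y0) (fun A : 'rV[R]_n => A 0 i) _ _ _ c1).
exact: coord_continuous.
Qed.

(** Provides the domination required to differentiate under the integral: [q] is continuous on the
    compact rectangle where |s| <= e and t runs through [0, 1]. *)
Let bound_q (x h : 'rV[R]_n) : ball y0 r x ->
  exists e C : R, [/\ 0 < e, forall s, `|s| <= e -> ball y0 r (x + s *: h) &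
   forall s t, `|s| <= e -> 0 <= t <= 1 -> `|q x h (s, t)| <= C].
Proof.
move=> xb.
have [e e0 he] : exists2 e : R, 0 < e & forall s, `|s| <= e -> ball y0 r (x + s *: h).
  have ob := ball_open y0 r.
  have cl : (fun s : R => x + s *: h) @ (0 : R) --> x.
    rewrite -[X in _ --> X]addr0 -[X in _ --> x + X](scale0r h).
    by apply: cvgD; [exact: cvg_cst|apply: cvgZr_tmp; exact: cvg_id].
  have /nbhs_ballP[d /= d0 H] := cl _ (open_nbhs_nbhs (conj ob xb)).
  exists (d / 2); first lra.
  by move=> s sd; apply: H; rewrite /ball/= sub0r normrN; lra.
pose K : set (R * R) := `[-e, e] `*` `[0, 1].
have cK : compact K by apply: compact_setX; exact: segment_compact.
have cq : {within K, continuous (q x h)}.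
  apply: continuous_in_subspaceT => z /set_mem [] /=; rewrite !in_itv /= => z1 z2.
  by apply: cont_q => //; apply: he; rewrite ler_norml.
have K0 : K !=set0.
  exists (0, 0); split; rewrite /= in_itv/= ?lexx ?ler01//.
  by rewrite oppr_le0 ltW.
have [c1 _ H1] := compact_EVT_max K0 cK cq.
have [c2 _ H2] := compact_EVT_min K0 cK cq.
exists e, (`|q x h c1| + `|q x h c2|); split=> // s t se t01.
have Kst : (s, t) \in K by rewrite inE; split; rewrite /= in_itv/= ?t01// -ler_norml.
have := H1 _ Kst; have := H2 _ Kst.
move: (q x h (s, t)) (q x h c1) (q x h c2) => a b c ca ab.
rewrite ler_norml; apply/andP; split.
  by have := ler_norm (- c); rewrite normrN; have := normr_ge0 b; lra.
by have := ler_norm b; have := normr_ge0 c; lra.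
Qed.

Lemma poincare_derive (x h : 'rV[R]_n) : ball y0 r x -> is_derive x h phi (w x h).
Proof.
move=> xb; have [e [C [e0 he HC]]] := bound_q h xb.
pose g (s t : R) := w (y0 + t *: (x + s *: h - y0)) (x + s *: h - y0).
have gE s : phi (x + s *: h) = \int[lebesgue_measure]_(t in `[0, 1]) g s t by [].
have ptU (s t : R) : `|s| <= e -> 0 <= t <= 1 -> U (y0 + t *: (x + s *: h - y0)).
  by move=> se t01; apply: ballU; apply: ball_seg => //; exact: he.
have dg (s t : R) : `|s| <= e -> 0 <= t <= 1 -> is_derive s 1 (g ^~ t) (q x h (s, t)).
  move=> se t01.
  have E1 (s' : R) : y0 + t *: (x + s' *: h - y0) = (y0 + t *: (x - y0)) + s' *: (t *: h).
    by rewrite addrAC scalerDr addrA; congr (_ + _); rewrite !scalerA mulrC.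
  have E2 (s' : R) : x + s' *: h - y0 = (x - y0) + s' *: h by rewrite addrAC.
  have Us : U ((y0 + t *: (x - y0)) + s *: (t *: h)) by rewrite -E1; exact: ptU.
  have := w_line_derive (x - y0) h Us.
  rewrite /g /q /=; under [in X in _ -> X]eq_fun do rewrite E1 E2.
  congr is_derive; rewrite E1 E2; congr (_ + _).
  rewrite mulr_sumr; apply: eq_bigr => i _.
  have dL := smooth_diff (sL i) Us.
  by rewrite (deriveE (t *: h) dL) linearZ -deriveE// mulrCA.
have Ig : `]-e, e[%classic 0 by rewrite /= in_itv /=; lra.
have se s : `]-e, e[%classic s -> `|s| <= e.
  by rewrite /= in_itv /= ler_norml => /andP[/ltW -> /ltW ->].
have intg s : `]-e, e[%classic s ->
    lebesgue_measure.-integrable `[0, 1] (EFin \o g s).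
  move=> /se /he xsb; apply: continuous_compact_integrable; first exact: segment_compact.
  exact: cont_seg.
have derg (s t : R) : `]-e, e[%classic s -> `[0, 1]%classic t -> derivable (g ^~ t) s 1.
  by move=> /se s1; rewrite /= in_itv /= => t1; case: (dg s t s1 t1).
have d1E (s t : R) : `]-e, e[%classic s -> `[0, 1]%classic t -> partial1of2 g s t = q x h (s, t).
  move=> /se s1; rewrite /= in_itv /= => t1; rewrite partial1of2E.
  by case: (dg s t s1 t1).
have C0 : 0 <= C by apply: le_trans (HC 0 0 _ _); rewrite ?normr0 ?lexx ?ler01// ltW.
have intC : lebesgue_measure.-integrable `[0 : R, 1] (EFin \o cst C).
  apply: continuous_compact_integrable; first exact: segment_compact.
  by apply: continuous_subspaceT => t; exact: cvg_cst.
have gC (s t : R) : `]-e, e[%classic s -> `[0, 1]%classic t -> `|partial1of2 g s t| <= C.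
  move=> s1 t1; rewrite d1E//; apply: HC; first exact: se.
  by move: t1; rewrite /= in_itv.
have cvgF := @cvg_differentiation_under_integral R _ _ lebesgue_measure g _
  (measurable_itv `[0, 1]) 0 (- e) e Ig intg derg (fun=> C) (fun=> C0) intC gC.
have intq : \int[lebesgue_measure]_(t in `[0, 1]) partial1of2 g 0 t = w x h.
  have -> : \int[lebesgue_measure]_(t in `[0, 1]) partial1of2 g 0 t
     = \int[lebesgue_measure]_(t in `[0, 1]) q x h (0, t).
    by apply: eq_Rintegral => t /set_mem t1; exact: d1E.
  (* By closedness the integrand is the derivative of [Q], and Q 1 - Q 0 = w x h. *)
  pose Q (t : R) := t * w (y0 + t *: (x - y0)) h.
  have Ut (t : R) : 0 <= t <= 1 -> U (y0 + t *: (x - y0)).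
    by move=> t1; apply: ballU; exact: ball_seg.
  have dQ (t : R) : 0 <= t <= 1 -> is_derive t 1 Q (q x h (0, t)).
    move=> t1; have := w_line_derive h 0 (Ut _ t1).
    under [X in is_derive _ _ X _]eq_fun do rewrite scaler0 addr0.
    move=> dw; have := is_deriveM (is_derive_id t 1) dw.
    congr is_derive.
    rewrite /q /= scale0r addr0 scaler0 addr0 addrC [_%:A]mulr1; congr (_ + _).
    have -> : w (y0 + t *: (x - y0)) 0 = 0 by rewrite /w big1// => i _; rewrite mxE mul0r.
    rewrite add0r.
    by rewrite -[X in _ * X](closed_derive _ _ (Ut _ t1)).
  have cq : {within `[0 : R, 1], continuous (fun t => q x h (0, t))}.
    apply: continuous_in_subspaceT => t /set_mem /=; rewrite in_itv /= => t1.
    have cp : continuous (fun t : R => (0 : R, t)).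
      by apply: continuous_pair => t'; [exact: cvg_cst|exact: cvg_id].
    apply: (@cvg_comp _ _ _ (fun t => (0, t)) (q x h) _ _ _ (cp t)).
    by apply: cont_q; rewrite //= scale0r addr0.
  have cQ (t : R) : 0 <= t <= 1 -> {for t, continuous Q}.
    move=> /dQ [dQt _]; apply: differentiable_continuous; exact/derivable1_diffP.
  have dQ01 : derivable_oo_LRcontinuous Q 0 1.
    split=> [t||].
    - by rewrite in_itv /= => /andP[/ltW a /ltW b]; case: (dQ t); rewrite ?a.
    - by apply: cvg_at_right_filter; apply: cQ; rewrite lexx ler01.
    - by apply: cvg_at_left_filter; apply: cQ; rewrite lexx ler01.
  have Q'q : {in `]0, 1[, derive1 Q =1 (fun t => q x h (0, t))}.
    move=> t; rewrite in_itv /= => /andP[/ltW a /ltW b].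
    by rewrite derive1E; case: (dQ t); rewrite ?a.
  rewrite /Rintegral (continuous_FTC2 ltr01 cq dQ01 Q'q) /= /Q mul0r subr0 mul1r scale1r.
  by rewrite addrC subrK.
have E : (fun s : R => s^-1 *: ((phi \o shift x) (s *: h) - phi x)) =
    (fun s : R => s^-1 *: (\int[lebesgue_measure]_(t in `[0, 1]) g (s + 0) t -
       \int[lebesgue_measure]_(t in `[0, 1]) g 0 t)).
  apply/funext => s; rewrite -!gE addr0 scale0r addr0 /=.
  by rewrite [s *: h + x]addrC.
move: cvgF; rewrite intq -E => cvgF.
by split; [apply/cvg_ex; exists (w x h)|exact: cvg_lim].
Qed.

(** The derivatives along lines from [poincare_derive] do not by themselves give differentiability.
    The mean value theorem on the segment from x to x + h expresses the increment by the form at an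
    intermediate point, and continuity of the [L i] bounds the error by e times the norm of h. *)
Lemma poincare_ball : exists F : 'rV[R]_n -> R, forall x, ball y0 r x ->
  differentiable F x /\ forall v, 'D_v F x = \sum_i v 0 i * L i x.
Proof.
exists phi => x xb; apply: (differentiable_o (df := w x)) => [a u v|v|e e0].
- rewrite /w scaler_sumr -big_split; apply: eq_bigr => i _ /=.
  by rewrite !mxE mulrDl -mulrA.
- have cw : \sum_i u 0 i * L i x @[u --> v] --> \sum_i v 0 i * L i x.
    apply: cvg_sumr => i; apply: cvgM; last exact: cvg_cst.
    exact: coord_continuous.
  exact: cw.
have /nbhs_ballP[d /= d0 Hd] : \forall y \near x, ball y0 r y /\ \sum_i `|L i y - L i x| < e.
  apply: filterI; first exact: (open_nbhs_nbhs (conj (ball_open y0 r) xb)).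
  have cLx i : {for x, continuous (L i)}.
    exact: differentiable_continuous (smooth_diff (sL i) (ballU xb)).
  exact: (continuous_sum_dist cLx e0).
near=> h.
have hd : `|h| < d.
  near: h; have := nbhsx_ballx (0 : 'rV[R]_n) d d0; apply: filterS => z.
  by rewrite -ball_normE /= sub0r normrN.
have Hc (c : R) : 0 <= c <= 1 -> ball y0 r (x + c *: h) /\ \sum_i `|L i (x + c *: h) - L i x| < e.
  move=> /andP[c0 c1]; apply: Hd.
  rewrite -ball_normE /= opprD addrA subrr sub0r normrN normrZ ger0_norm//.
  by apply: le_lt_trans hd; rewrite ler_piMl.
have dF (c : R) : 0 <= c <= 1 -> is_derive c 1 (fun c : R => phi (x + c *: h)) (w (x + c *: h) h).
  by move=> /Hc[bc _]; exact: is_derive_line (poincare_derive h bc).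
have [c c01] : exists2 c : R, c \in `]0, 1[ &
    phi (x + 1 *: h) - phi (x + 0 *: h) = w (x + c *: h) h * (1 - 0).
  apply: (@MVT _ (fun c : R => phi (x + c *: h)) (fun c : R => w (x + c *: h) h)) => //.
    by move=> c; rewrite in_itv /= => /andP[/ltW a /ltW b]; apply: dF; rewrite a.
  apply: derivable_within_continuous => c; rewrite in_itv /= => cc.
  by case: (dF c cc).
rewrite scale1r scale0r addr0 subr0 mulr1 [h + x]addrC => ->.
rewrite /w -sumrB; apply: le_trans (ler_norm_sum _ _ _) _.
have cc : 0 <= c <= 1 by move: c01; rewrite in_itv /= => /andP[/ltW -> /ltW ->].
apply: (@le_trans _ _ (`|h| * \sum_i `|L i (x + c *: h) - L i x|)).
  rewrite mulr_sumr; apply: ler_sum => i _; rewrite -mulrBr normrM ler_wpM2r//.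
  rewrite [leRHS]/Num.Def.normr /= mx_normrE.
  exact: (le_bigmax _ (fun ij => `|h ij.1 ij.2|) (0, i)).
by rewrite mulrC ler_wpM2r// ltW//; case: (Hc c cc).
Unshelve. all: end_near. Qed.

End Poincare.

(** * Symmetry of second derivatives *)

Section Schwarz.
Context {R : realType}.

(** The mean value theorem twice: in the direction u for the difference of F across e v, then in the
    direction v for the derivative of F along u. *)
Lemma second_difference n (U : set 'rV[R]_n) (F : 'rV[R]_n -> R) (x u v : 'rV[R]_n) (e : R) :
  smooth_on U F -> (forall s t, 0 <= s <= e -> 0 <= t <= e -> U (x + s *: u + t *: v)) -> 0 < e ->
  exists s t, [/\ 0 <= s <= e, 0 <= t <= e &
    F (x + e *: u + e *: v) - F (x + e *: u) - (F (x + e *: v) - F x) =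
    'D_v (fun y => 'D_u F y) (x + s *: u + t *: v) * e * e].
Proof.
move=> sF HU e0.
have swap s t : x + s *: u + t *: v = x + t *: v + s *: u by rewrite addrAC.
have dF s t : 0 <= s <= e -> 0 <= t <= e ->
    is_derive s 1 (fun s : R => F (x + t *: v + s *: u)) ('D_u F (x + t *: v + s *: u)).
  move=> s1 t1; apply: is_derive_line; apply: derivableP; apply: diff_derivable.
  by apply: (smooth_diff sF); rewrite -swap; exact: HU.
have e1 : 0 <= e <= e by rewrite lexx ltW.
have z1 : 0 <= (0 : R) <= e by rewrite lexx ltW.
pose k (s : R) := F (x + e *: v + s *: u) - F (x + 0 *: v + s *: u).
pose dk (s : R) := 'D_u F (x + e *: v + s *: u) - 'D_u F (x + 0 *: v + s *: u).
have dkE s : 0 <= s <= e -> is_derive s 1 k (dk s).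
  by move=> s1; apply: is_deriveB; exact: dF.
have [||s s01 sE] := @MVT R k dk 0 e e0.
- by move=> s; rewrite in_itv /= => /andP[/ltW a /ltW b]; apply: dkE; rewrite a.
- by apply: derivable_within_continuous => s; rewrite in_itv /= => cc; case: (dkE s cc).
have s1 : 0 <= s <= e by move: s01; rewrite in_itv /= => /andP[/ltW -> /ltW ->].
pose l (t : R) := 'D_u F (x + s *: u + t *: v).
pose dl (t : R) := 'D_v (fun y => 'D_u F y) (x + s *: u + t *: v).
have dlE t : 0 <= t <= e -> is_derive t 1 l (dl t).
  move=> t1; apply: (@is_derive_line R _ _ (fun y => 'D_u F y)).
  apply: derivableP; apply: diff_derivable.
  by apply: (smooth_diff (smooth_derive u sF)); exact: HU.
have [||t t01 tE] := @MVT R l dl 0 e e0.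
- by move=> t; rewrite in_itv /= => /andP[/ltW a /ltW b]; apply: dlE; rewrite a.
- by apply: derivable_within_continuous => t; rewrite in_itv /= => cc; case: (dlE t cc).
have t1 : 0 <= t <= e by move: t01; rewrite in_itv /= => /andP[/ltW -> /ltW ->].
exists s, t; split=> //.
have -> : F (x + e *: u + e *: v) - F (x + e *: u) - (F (x + e *: v) - F x) = k e - k 0.
  by rewrite /k !scale0r !addr0 -(swap e e); lra.
by rewrite sE /dk -!swap -/(l e) -/(l 0) tE !subr0.
Qed.

(** The second difference is symmetric in u and v. Hence a value of one mixed derivative equals a
    value of the other at points arbitrarily close to x, and both are continuous at x. *)
Lemma derive_comm n (U : set 'rV[R]_n) (F : 'rV[R]_n -> R) x u v :
  open U -> smooth_on U F -> U x ->
  'D_v (fun y => 'D_u F y) x = 'D_u (fun y => 'D_v F y) x.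
Proof.
move=> oU sF Ux; apply/eqP; rewrite -subr_eq0 -normr_le0; apply/ler_addgt0Pr => eps eps0.
rewrite add0r.
set A := fun y => 'D_v (fun y => 'D_u F y) y; set B := fun y => 'D_u (fun y => 'D_v F y) y.
have cA : {for x, continuous A}.
  exact: differentiable_continuous (smooth_diff (smooth_derive v (smooth_derive u sF)) Ux).
have cB : {for x, continuous B}.
  exact: differentiable_continuous (smooth_diff (smooth_derive u (smooth_derive v sF)) Ux).
have e20 : 0 < eps / 2 by lra.
have near_x : \forall y \near x, [/\ U y, `|A x - A y| < eps / 2 & `|B x - B y| < eps / 2].
  have hA : \forall y \near x, `|A x - A y| < eps / 2.
    exact: ((@cvgrPdist_lt _ _ _ (nbhs x) _ A (A x)).1 cA).
  have hB : \forall y \near x, `|B x - B y| < eps / 2.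
    exact: ((@cvgrPdist_lt _ _ _ (nbhs x) _ B (B x)).1 cB).
  have hU := open_nbhs_nbhs (conj oU Ux).
  by apply: filterS3 hU hA hB => y.
have [d /= d0 Hd] := (nbhs_ballP _ _).1 near_x.
(* The parallelogram spanned by e u and e v at x then stays within d / 2 of x; the summand 1 keeps
   the denominator positive when u and v vanish. *)
pose e := d / (2 * (1 + `|u| + `|v|)).
have uv0 : 0 < 1 + `|u| + `|v| by have := normr_ge0 u; have := normr_ge0 v; lra.
have e0 : 0 < e by rewrite divr_gt0// mulr_gt0.
have Hst s t : 0 <= s <= e -> 0 <= t <= e -> ball x d (x + s *: u + t *: v).
  move=> /andP[s0 s1] /andP[t0 t1].
  rewrite -ball_normE /= -addrA opprD addrA subrr sub0r normrN.
  apply: (le_lt_trans (ler_normD _ _)); rewrite !normrZ !ger0_norm//.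
  have h1 : s * `|u| <= e * `|u| by rewrite ler_wpM2r.
  have h2 : t * `|v| <= e * `|v| by rewrite ler_wpM2r.
  have eE : e * (1 + `|u| + `|v|) = d / 2.
    by rewrite /e; field; rewrite gt_eqF.
  by lra.
have Hst' s t : 0 <= s <= e -> 0 <= t <= e -> ball x d (x + s *: v + t *: u).
  by move=> h1 h2; rewrite addrAC; exact: Hst.
have [s [t [s1 t1 E1]]] := second_difference sF
  (fun s t a b => let: And3 a _ _ := Hd _ (Hst s t a b) in a) e0.
have [s' [t' [s1' t1' E2]]] := second_difference sF
  (fun s t a b => let: And3 a _ _ := Hd _ (Hst' s t a b) in a) e0.
have EAB : A (x + s *: u + t *: v) = B (x + s' *: v + t' *: u).
  have : A (x + s *: u + t *: v) * e * e = B (x + s' *: v + t' *: u) * e * e.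
    have sq (a b c a' : R) : a - b - (c - a') = a - c - (b - a') by ring.
    by apply: (etrans (esym E1)); apply: (etrans _ E2); rewrite [x + e *: v + e *: u]addrAC sq.
  by move/(mulIf (lt0r_neq0 e0))/(mulIf (lt0r_neq0 e0)).
have [_ h1 _] := Hd _ (Hst s t s1 t1).
have [_ _ h2] := Hd _ (Hst' s' t' s1' t1').
clear E1 E2; change (`|A x - B x| <= eps); move: h1 h2; rewrite EAB.
move: (A x) (B x) (B _) => a b c ac bc.
have -> : a - b = (a - c) - (b - c) by lra.
by apply: (le_trans (ler_normB _ _)); move: ac bc; lra.
Qed.

End Schwarz.

(** * Smooth functions and closed one-forms on a manifold *)

Section Manifold_calculus.
Context {R : realType} {n : nat} {M : smoothManifold R n}.

Lemma near_chart_img (p : M) y : chart_img p y -> \forall z \near y, chart_img p z.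
Proof. by move=> py; apply: open_nbhs_nbhs; split=> //; exact: open_chart_img. Qed.

Lemma near_chart_dom (p q : M) : chart_dom p q -> \forall r \near q, chart_dom p r.
Proof. by move=> pq; apply: open_nbhs_nbhs; split=> //; exact: open_chart_dom. Qed.

(** Chain rule through the transition map. Differentiability is assumed in the chart at q only and
    obtained in the chart at p, so a primitive built in one chart can be read in all others. *)
Lemma chart_change (V : normedModType R) (F : M -> V) (p q : M) y :
  chart_img p y -> chart_dom q (chart_inv p y) ->
  differentiable (F \o chart_inv q) (chart q (chart_inv p y)) ->
  differentiable (F \o chart_inv p) y /\
  forall u, 'D_u (F \o chart_inv p) y =
    'D_('D_u (chart q \o chart_inv p) y) (F \o chart_inv q) (chart q (chart_inv p y)).
Proof.
move=> py qy dF.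
have [/(_ y (conj py qy)) dc _] := chart_compat p q 1.
have nE : \forall z \near y,
    ((F \o chart_inv q) \o (chart q \o chart_inv p)) z = (F \o chart_inv p) z.
  have near_q : \forall z \near y, chart_dom q (chart_inv p z).
    exact: chart_inv_continuous py _ (near_chart_dom qy).
  by apply: filterS near_q => z qz /=; rewrite chartK.
have dcomp : differentiable ((F \o chart_inv q) \o (chart q \o chart_inv p)) y.
  exact: differentiable_comp.
have dFp : differentiable (F \o chart_inv p) y := near_eq_differentiable nE dcomp.
split=> // u.
rewrite -(near_eq_derive u nE) deriveE//.
have -> : 'd ((F \o chart_inv q) \o (chart q \o chart_inv p)) y =
   'd (F \o chart_inv q) (chart q (chart_inv p y)) \o 'd (chart q \o chart_inv p) y :> (_ -> _).
  exact: diff_comp.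
by rewrite /= -deriveE// -deriveE.
Qed.

Lemma smooth_chart_diff (V : normedModType R) (F : M -> V) (p : M) y :
  smooth F -> chart_img p y -> differentiable (F \o chart_inv p) y.
Proof. by move=> sF py; exact: smooth_diff (sF p) py. Qed.

(** Tangent vectors at a point are written in the chart centred there, so a coordinate vector of
    another chart has to be pushed through the transition map first. [md_derive] is the translation
    in the opposite direction. *)
Lemma derive_md (V : normedModType R) (F : M -> V) (p : M) y u : smooth F -> chart_img p y ->
  'D_u (F \o chart_inv p) y =
  md F (chart_inv p y) ('D_u (chart (chart_inv p y) \o chart_inv p) y).
Proof.
move=> sF py.
have cd := chart_dom_center (chart_inv p y).
by have [] := chart_change py cd (smooth_chart_diff sF (chart_in cd)).
Qed.

Lemma md_derive (V : normedModType R) (F : M -> V) (p q : M) v : smooth F -> chart_dom p q ->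
  md F q v = 'D_(md (chart p) q v) (F \o chart_inv p) (chart p q).
Proof.
move=> sF pq; have cq := chart_in (chart_dom_center q).
have qE : chart_inv q (chart q q) = q by apply: chartK; exact: chart_dom_center.
have pq' : chart_dom p (chart_inv q (chart q q)) by rewrite qE.
have dF : differentiable (F \o chart_inv p) (chart p (chart_inv q (chart q q))).
  by apply: smooth_chart_diff => //; exact: chart_in.
by have [_ e] := chart_change cq pq' dF; rewrite [LHS]/md e qE.
Qed.

Lemma md_linear (V : normedModType R) (F : M -> V) p : smooth F -> linear (md F p).
Proof.
move=> sF a u v; rewrite /md.
have dF := smooth_chart_diff sF (chart_in (chart_dom_center p)).
by rewrite !deriveE// linearP.
Qed.

Lemma md0 (V : normedModType R) (F : M -> V) p : md F p 0 = 0.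
Proof. exact: derive0. Qed.

Lemma mdvD (V : normedModType R) (F : M -> V) p u v : smooth F ->
  md F p (u + v) = md F p u + md F p v.
Proof. by move=> sF; have := @md_linear V F p sF 1 u v; rewrite !scale1r. Qed.

Lemma mdvZ (V : normedModType R) (F : M -> V) p a u : smooth F ->
  md F p (a *: u) = a *: md F p u.
Proof. by move=> sF; have := @md_linear V F p sF a u 0; rewrite md0 !addr0. Qed.

Lemma mdvN (V : normedModType R) (F : M -> V) p u : smooth F ->
  md F p (- u) = - md F p u.
Proof. by move=> sF; rewrite -scaleN1r mdvZ// scaleN1r. Qed.

Lemma mdvB (V : normedModType R) (F : M -> V) p u v : smooth F ->
  md F p (u - v) = md F p u - md F p v.
Proof. by move=> sF; rewrite mdvD// mdvN. Qed.

Lemma msmoothD (V : normedModType R) (F G : M -> V) :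
  smooth F -> smooth G -> smooth (fun p => F p + G p).
Proof. by move=> sF sG p; exact: (smoothD (@open_chart_img _ _ M p) (sF p) (sG p)). Qed.

Lemma msmoothM (F G : M -> R) : smooth F -> smooth G -> smooth (fun p => F p * G p).
Proof. by move=> sF sG p; exact: (smoothM (@open_chart_img _ _ M p) (sF p) (sG p)). Qed.

Lemma msmooth_cst (V : normedModType R) (a : V) : smooth (fun _ : M => a).
Proof. by move=> p; exact: smooth_cst. Qed.

Lemma msmooth_sum (V : normedModType R) (I : Type) (r : seq I) (F : I -> M -> V) :
  (forall i, smooth (F i)) -> smooth (fun p => \sum_(i <- r) F i p).
Proof.
by move=> sF p; exact: (smooth_sum (@open_chart_img _ _ M p) r (P := xpredT) (fun i _ => sF i p)).
Qed.

Lemma msmooth_mxP a b (F : M -> 'M[R]_(a, b)) :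
  smooth F <-> forall i j, smooth (fun p => F p i j).
Proof.
split=> [sF i j p|sF p]; first exact: ((smooth_mxP (@open_chart_img _ _ M p) _).1 (sF p)).
by apply/(smooth_mxP (@open_chart_img _ _ M p)) => i j; exact: sF.
Qed.

Lemma msmooth_mulmx a b c (F : M -> 'M[R]_(a, b)) (G : M -> 'M[R]_(b, c)) :
  smooth F -> smooth G -> smooth (fun p => F p *m G p).
Proof. by move=> sF sG p; exact: (smooth_mulmx (@open_chart_img _ _ M p) (sF p) (sG p)). Qed.

Lemma msmooth_trmx a b (F : M -> 'M[R]_(a, b)) : smooth F -> smooth (fun p => (F p)^T).
Proof. by move=> sF p; exact: (smooth_trmx (@open_chart_img _ _ M p) (sF p)). Qed.

Lemma msmoothZ (V : normedModType R) (a : R) (F : M -> V) : smooth F -> smooth (fun p => a *: F p).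
Proof.
move=> sF p; apply: (smooth_linear (@open_chart_img _ _ M p) (l := fun v : V => a *: v)) (sF p).
  by move=> b u v; rewrite scalerDr !scalerA mulrC.
exact: scaler_continuous.
Qed.

Lemma msmoothN (V : normedModType R) (F : M -> V) : smooth F -> smooth (fun p => - F p).
Proof.
by move=> sF; have := msmoothZ (-1) sF; congr smooth; apply/funext => p; rewrite scaleN1r.
Qed.

Lemma msmoothB (V : normedModType R) (F G : M -> V) :
  smooth F -> smooth G -> smooth (fun p => F p - G p).
Proof. by move=> sF /msmoothN; exact: msmoothD. Qed.

Lemma smooth_center (V : normedModType R) (F : M -> V) p v :
  smooth F -> is_derive (chart p p) v (F \o chart_inv p) (md F p v).
Proof.
move=> sF; apply: derivableP; apply: diff_derivable.
exact: smooth_chart_diff (chart_in (chart_dom_center p)).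
Qed.

Lemma md_cst (V : normedModType R) (a : V) (p : M) v : md (fun=> a) p v = 0.
Proof. exact: derive_cst. Qed.

Lemma mdD (V : normedModType R) (F G : M -> V) p v : smooth F -> smooth G ->
  md (fun q => F q + G q) p v = md F p v + md G p v.
Proof.
by move=> /(smooth_center p v) dF /(smooth_center p v) dG; have [_ <-] := is_deriveD dF dG.
Qed.

Lemma mdZ (V : normedModType R) (a : R) (F : M -> V) p v : smooth F ->
  md (fun q => a *: F q) p v = a *: md F p v.
Proof. by move=> /(smooth_center p v) dF; have [_ <-] := is_deriveZ a dF. Qed.

Lemma mdN (V : normedModType R) (F : M -> V) p v : smooth F ->
  md (fun q => - F q) p v = - md F p v.
Proof. by move=> /(smooth_center p v) dF; have [_ <-] := is_deriveN dF. Qed.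

Lemma mdB (V : normedModType R) (F G : M -> V) p v : smooth F -> smooth G ->
  md (fun q => F q - G q) p v = md F p v - md G p v.
Proof. by move=> sF sG; rewrite mdD ?mdN//; exact: msmoothN. Qed.

Lemma mdM (F G : M -> R) p v : smooth F -> smooth G ->
  md (fun q => F q * G q) p v = md F p v * G p + F p * md G p v.
Proof.
move=> /(smooth_center p v) dF /(smooth_center p v) dG; have [_] := is_deriveM dF dG.
have pE : chart_inv p (chart p p) = p by apply: chartK; exact: chart_dom_center.
by rewrite /= pE => e; rewrite addrC [md F p v * _]mulrC; exact: e.
Qed.

Lemma md_sum (V : normedModType R) (I : Type) (r : seq I) (F : I -> M -> V) p v :
  (forall i, smooth (F i)) ->
  md (fun q => \sum_(i <- r) F i q) p v = \sum_(i <- r) md (F i) p v.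
Proof.
move=> sF; elim: r => [|i r IH].
  by under eq_fun do rewrite big_nil; rewrite big_nil md_cst.
under eq_fun do rewrite big_cons.
by rewrite big_cons -IH mdD//; exact: msmooth_sum.
Qed.

Lemma md_mxE a b (F : M -> 'M[R]_(a, b)) p v i j : smooth F ->
  md F p v i j = md (fun q => F q i j) p v.
Proof.
by move=> /(smooth_center p v) [dF _]; rewrite /md derive_mx// mxE.
Qed.

Lemma md_mulmx a b c (F : M -> 'M[R]_(a, b)) (G : M -> 'M[R]_(b, c)) p v :
  smooth F -> smooth G ->
  md (fun q => F q *m G q) p v = md F p v *m G p + F p *m md G p v.
Proof.
move=> sF sG; apply/matrixP => i j; rewrite md_mxE; last exact: msmooth_mulmx.
have sF' := (msmooth_mxP _).1 sF; have sG' := (msmooth_mxP _).1 sG.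
rewrite 3!mxE -big_split /=; under eq_fun do rewrite mxE.
rewrite md_sum; last by move=> k; exact: msmoothM.
by apply: eq_bigr => k _; rewrite mdM// !md_mxE.
Qed.

Lemma md_trmx a b (F : M -> 'M[R]_(a, b)) p v : smooth F ->
  md (fun q => (F q)^T) p v = (md F p v)^T.
Proof.
move=> sF; apply/matrixP => i j; rewrite md_mxE; last exact: msmooth_trmx.
by under eq_fun do rewrite mxE; rewrite mxE md_mxE.
Qed.

Lemma smooth_md_vfield (a b : nat) (F : M -> 'M[R]_(a, b)) (X : M -> 'rV[R]_n) :
  smooth F -> vfield X -> smooth (fun p => md F p (X p)).
Proof.
move=> sF vX; apply/msmooth_mxP => i j p.
have sFij := (msmooth_mxP _).1 sF i j.
have sX := (smooth_mxP (@open_chart_img _ _ M p) _).1 (vX p).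
have sd k : smooth_on (chart_img p)
    (fun y => 'D_(delta_mx 0 k) ((fun q => F q i j) \o chart_inv p) y : R).
  by apply: smooth_derive; exact: sFij.
have := smooth_sum (@open_chart_img _ _ M p) (index_enum 'I_n) (P := xpredT)
  (fun k _ => smoothM (@open_chart_img _ _ M p) (sX 0 k) (sd k)).
apply: smooth_on_eq => [|y py]; first exact: open_chart_img.
rewrite /= md_mxE// (md_derive _ sFij (chart_inv_in py)) chart_invK//.
by rewrite derive_rV//; exact: smooth_chart_diff.
Qed.

End Manifold_calculus.

(** * Exactness of closed one-forms on a simply connected manifold *)

Section Exact_forms.
Context {R : realType} {n : nat} {M : smoothManifold R n}.

Lemma derive0_ball_cst (h : 'rV[R]_n -> R) y0 r y :
  (forall z, ball y0 r z -> differentiable h z /\ forall v, 'D_v h z = 0) ->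
  ball y0 r y -> h y = h y0.
Proof.
move=> h0 yb.
have dh (t : R) : 0 <= t <= 1 -> is_derive t 1 (fun t : R => h (y0 + t *: (y - y0))) 0.
  move=> /andP[t0 t1]; apply: is_derive_line.
  have [|dh d0] := h0 (y0 + t *: (y - y0)).
    move: yb; rewrite -ball_normE /= opprD addrA subrr sub0r normrN normrZ ger0_norm// distrC => yb.
    by apply: le_lt_trans yb; rewrite ler_piMl.
  by split; [exact: diff_derivable|exact: d0].
have [||t _] := @MVT _ (fun t : R => h (y0 + t *: (y - y0))) (cst 0) 0 1 ltr01.
- by move=> t; rewrite in_itv /= => /andP[/ltW a /ltW b]; apply: dh; rewrite a.
- by apply: derivable_within_continuous => t; rewrite in_itv /= => tt; case: (dh t tt).
by rewrite /= mul0r scale1r scale0r addr0 [y0 + _]addrC subrK => /eqP; rewrite subr_eq0 => /eqP.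
Qed.

Lemma near_chart (p : M) (P : set 'rV[R]_n) : nbhs (chart p p) P ->
  \forall q \near p, chart_dom p q /\ P (chart p q).
Proof.
move=> nP; have pp := chart_dom_center p; apply: filterI; first exact: near_chart_dom.
exact: chart_continuous pp _ nP.
Qed.

(** Differentiability is required near p only: the lemma serves for the difference of two local
    primitives, which mean nothing elsewhere, and also for global functions. *)
Lemma md0_locally_cst (F : M -> R) (U : set M) (p : M) : nbhs p U ->
  (forall q, U q -> forall p' y, chart_img p' y -> chart_inv p' y = q ->
     differentiable (F \o chart_inv p') y /\ forall v, 'D_v (F \o chart_inv p') y = 0) ->
  \forall q \near p, F q = F p.
Proof.
move=> nU F0; have cp := chart_in (chart_dom_center p).
have pE : chart_inv p (chart p p) = p by apply: chartK; exact: chart_dom_center.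
have nU' : \forall y \near chart p p, chart_img p y /\ U (chart_inv p y).
  apply: filterI; first exact: near_chart_img.
  by apply: chart_inv_continuous cp _ _; rewrite pE.
have [r /= r0 Hr] := (nbhs_ballP _ _).1 nU'.
have := near_chart (nbhsx_ballx (chart p p) _ r0); apply: filterS => q [pq qb].
have := @derive0_ball_cst (F \o chart_inv p) (chart p p) r (chart p q) _ qb.
rewrite /= pE chartK//; apply=> z /Hr[pz Uz]; exact: F0 Uz _ _ pz _.
Qed.

Lemma md0_cst (M_sc : simply_connected R M) (F : M -> R) : smooth F ->
  (forall p v, md F p v = 0) -> forall p q, F p = F q.
Proof.
move=> sF F0 p q.
have loc x : \forall y \near x, F y = F x.
  apply: (@md0_locally_cst _ setT); first exact: filterT.
  move=> z _ p' y p'y yz; split=> [|v]; first exact: smooth_chart_diff.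
  by rewrite derive_md.
have [_ pc _] := M_sc; have [g [cg <- <-]] := pc p q.
have cgc : continuous (g \o clamp).
  by apply: (within_continuous_comp cg (@continuous_clamp R)) => x; rewrite /= in_itv/= clamp_itv.
have locg t : [set t : R | 0 <= t <= 1] t -> \forall s \near t, [set t : R | 0 <= t <= 1] s ->
    (F \o (g \o clamp)) s = (F \o (g \o clamp)) t.
  have H : \forall s \near t, F ((g \o clamp) s) = F ((g \o clamp) t).
    exact: cgc t _ (loc ((g \o clamp) t)).
  by move=> _; apply: filterS H => s /= ->.
have i0 : [set t : R | 0 <= t <= 1] 0 by rewrite /= lexx ler01.
have i1 : [set t : R | 0 <= t <= 1] 1 by rewrite /= lexx ler01.
have := locally_cst_connected (@connected_I R 0 1) locg i0 i1.
by rewrite /= !clamp_id.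
Qed.

Lemma manifold_locpath (p : M) (U : set M) : nbhs p U -> \forall q \near p,
  exists sigma : R -> M, [/\ continuous sigma, sigma 0 = p, sigma 1 = q &
    forall t, 0 <= t <= 1 -> U (sigma t)].
Proof.
move=> nU; have cp := chart_in (chart_dom_center p).
have pE : chart_inv p (chart p p) = p by apply: chartK; exact: chart_dom_center.
have nU' : \forall y \near chart p p, chart_img p y /\ U (chart_inv p y).
  apply: filterI; first exact: near_chart_img.
  by apply: chart_inv_continuous cp _ _; rewrite pE.
have [r /= r0 Hr] := (nbhs_ballP _ _).1 nU'.
have := near_chart (nbhsx_ballx (chart p p) _ r0); apply: filterS => q [pq qb].
pose s (t : R) := chart p p + clamp t *: (chart p q - chart p p).
have sb t : ball (chart p p) r (s t).
  move: qb; rewrite -ball_normE /= opprD addrA subrr sub0r normrN normrZ distrC => qb.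
  have /andP[c0 c1] := clamp_itv t; rewrite ger0_norm//.
  by apply: le_lt_trans qb; rewrite ler_piMl.
exists (chart_inv p \o s); split.
- move=> t; apply: (@cvg_comp _ _ _ s (chart_inv p) _ (nbhs (s t))).
    apply: cvgD; first exact: cvg_cst.
    by apply: cvgZr_tmp; exact: continuous_clamp.
  by apply: chart_inv_continuous; case: (Hr _ (sb t)).
- by rewrite /s /= clamp_id ?lexx ?ler01// scale0r addr0.
- by rewrite /s /= clamp_id ?lexx ?ler01// scale1r addrC subrK chartK.
- by move=> t _; case: (Hr _ (sb t)).
Qed.

Variables (k : nat) (w f : 'I_k -> M -> R).
Hypothesis sw : forall a, smooth (w a).
Hypothesis sf : forall a, smooth (f a).
(** The vanishing of the sum of the dw_a /\ df_a, that is, closedness of the form expressed without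
    coordinates. *)
Hypothesis wf_closed : forall q u v,
  \sum_a md (w a) q u * md (f a) q v = \sum_a md (w a) q v * md (f a) q u.

(** Required in every chart around q, and not only in the one centred at q, because smoothness is
    tested in all charts. *)
Definition primitive_at (F : M -> R) (q : M) := forall p y, chart_img p y -> chart_inv p y = q ->
  differentiable (F \o chart_inv p) y /\
  forall v, 'D_v (F \o chart_inv p) y = \sum_a w a q * 'D_v (f a \o chart_inv p) y.

Lemma local_primitive (p : M) : exists F : M -> R, \forall q \near p, primitive_at F q.
Proof.
have oU : open (chart_img p) := @open_chart_img _ _ M p.
pose L i y := \sum_a (w a \o chart_inv p) y * 'D_(delta_mx 0 i) (f a \o chart_inv p) y.
have sL i : smooth_on (chart_img p) (L i).
  apply: (smooth_sum oU (index_enum _) (P := xpredT)) => a _.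
  by apply: (smoothM oU); [exact: sw|exact: smooth_derive (sf a p)].
(* Of the two sums, the first is symmetric under exchange of the two directions by [wf_closed], the
   second by the symmetry of second derivatives; together they make the coefficients [L i]
   closed. *)
have LE i u y : chart_img p y -> 'D_u (L i) y =
    \sum_a md (w a) (chart_inv p y) ('D_u (chart (chart_inv p y) \o chart_inv p) y) *
       md (f a) (chart_inv p y) ('D_(delta_mx 0 i) (chart (chart_inv p y) \o chart_inv p) y) +
    \sum_a w a (chart_inv p y) * 'D_u (fun z => 'D_(delta_mx 0 i) (f a \o chart_inv p) z) y.
  move=> py.
  have H a : is_derive y u
     (fun y => (w a \o chart_inv p) y * 'D_(delta_mx 0 i) (f a \o chart_inv p) y)
     (md (w a) (chart_inv p y) ('D_u (chart (chart_inv p y) \o chart_inv p) y) *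
       md (f a) (chart_inv p y) ('D_(delta_mx 0 i) (chart (chart_inv p y) \o chart_inv p) y) +
      w a (chart_inv p y) * 'D_u (fun z => 'D_(delta_mx 0 i) (f a \o chart_inv p) z) y).
    have d1 := derivableP (diff_derivable (v := u) (smooth_chart_diff (sw a) py)).
    have d2 := derivableP (diff_derivable (v := u)
      (smooth_diff (smooth_derive (delta_mx 0 i) (sf a p)) py)).
    apply: (is_derive_eq (is_deriveM d1 d2)).
    by rewrite addrC -!derive_md//; congr (_ + _); exact: mulrC.
  have := is_derive_sum H; rewrite -big_split /= => -[_ <-].
  by congr ('D_u _ y); apply/funext => z; rewrite fct_sumE.
have closedL i j y : chart_img p y -> 'D_(delta_mx 0 i) (L j) y = 'D_(delta_mx 0 j) (L i) y.
  move=> py.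
  have e2 : \sum_a w a (chart_inv p y) *
       'D_(delta_mx 0 i) (fun z => 'D_(delta_mx 0 j) (f a \o chart_inv p) z) y =
     \sum_a w a (chart_inv p y) *
       'D_(delta_mx 0 j) (fun z => 'D_(delta_mx 0 i) (f a \o chart_inv p) z) y.
    apply: eq_bigr => a _; apply: (congr1 (fun t => w a (chart_inv p y) * t)).
    exact: (derive_comm _ _ oU (sf a p) py).
  apply: (etrans (LE _ _ _ py)); apply: (etrans _ (esym (LE _ _ _ py))).
  exact: (f_equal2 +%R (wf_closed _ _ _) e2).
have [r /= r0 Hr] := (nbhs_ballP _ _).1 (near_chart_img (chart_in (chart_dom_center p))).
have [phi Hphi] := poincare_ball sL closedL Hr.
exists (phi \o chart p).
have := near_chart (nbhsx_ballx (chart p p) _ r0); apply: filterS => q [pq qb] p' y p'y yq.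
have nE : \forall z \near chart p q, phi z = ((phi \o chart p) \o chart_inv p) z.
  by have := near_chart_img (chart_in pq); apply: filterS => z pz /=; rewrite chart_invK.
have [dphi Dphi] := Hphi _ qb.
have dF := near_eq_differentiable nE dphi.
have pq' : chart_dom p (chart_inv p' y) by rewrite yq.
rewrite -yq in dF.
have [dF' DF'] := chart_change p'y pq' dF.
split=> // v; rewrite DF' yq -(near_eq_derive _ nE) Dphi.
set v' := 'D_v _ y.
transitivity (\sum_a w a q * \sum_i v' 0 i * 'D_(delta_mx 0 i) (f a \o chart_inv p) (chart p q)).
  rewrite /L; under eq_bigr do rewrite mulr_sumr.
  rewrite exchange_big /=; apply: eq_bigr => a _; rewrite mulr_sumr; apply: eq_bigr => i _.
  by rewrite chartK//; ring.
apply: eq_bigr => a _; congr (_ * _).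
rewrite -derive_rV; last by apply: smooth_chart_diff => //; exact: chart_in.
have dfa := smooth_chart_diff (sf a) (chart_in pq').
by have [_ ->] := chart_change p'y pq' dfa; rewrite yq.
Qed.

(** The directional derivatives of G are given by a formula in smooth functions, so each order of
    smoothness is immediate and no bootstrapping takes place. *)
Lemma primitive_smooth (G : M -> R) : (forall q, primitive_at G q) ->
  smooth G /\ forall q v, md G q v = \sum_a w a q * md (f a) q v.
Proof.
move=> PG; split=> [p|q v]; last first.
  have pE : chart_inv q (chart q q) = q by apply: chartK; exact: chart_dom_center.
  by have [_ H] := PG q q _ (chart_in (chart_dom_center q)) pE; exact: H.
have oU : open (chart_img p) := @open_chart_img _ _ M p.
case=> [|i]; first by move=> y py; apply: differentiable_continuous; case: (PG _ _ _ py erefl).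
split=> [y py|v]; first by case: (PG _ _ _ py erefl).
have : smooth_on (chart_img p)
    (fun y => \sum_a (w a \o chart_inv p) y * 'D_v (f a \o chart_inv p) y).
  apply: (smooth_sum oU (index_enum _) (P := xpredT)) => a _.
  by apply: (smoothM oU); [exact: sw|exact: smooth_derive (sf a p)].
move=> /(_ i); apply: Ck_eq => // y py.
by case: (PG _ _ _ py erefl) => _ ->.
Qed.

Lemma exact_form (M_sc : simply_connected R M) : exists F : M -> R,
  smooth F /\ forall q v, md F q v = \sum_a w a q * md (f a) q v.
Proof.
have [F HF] := choice local_primitive.
have compat p : \forall q \near p, exists c, \forall r \near q, F p r = F q r + c.
  have := nbhs_interior (HF p); apply: filterS => q HFp.
  exists (F p q - F q q).
  have nU : nbhs q (primitive_at (F p) `&` primitive_at (F q)).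
    by apply: filterI; [exact: HFp|exact: HF].
  have H : \forall r \near q, F p r - F q r = F p q - F q q.
    apply: (@md0_locally_cst (fun r => F p r - F q r) _ q nU).
    move=> r [Pp Pq] p' y p'y yr.
    have [d1 D1] := Pp _ _ p'y yr; have [d2 D2] := Pq _ _ p'y yr.
    split=> [|v]; first exact: differentiableB d1 d2.
    have [_] := is_deriveB (derivableP (diff_derivable (v := v) d1))
      (derivableP (diff_derivable (v := v) d2)).
    by rewrite D1 D2 subrr.
  by apply: filterS H => r e; rewrite -e addrC subrK.
have [G HG] := simply_connected_glue compat manifold_locpath M_sc.
exists G; apply: primitive_smooth => q p y py yq.
have [dF DF] := nbhs_singleton (HF q) _ _ py yq.
have nE : \forall z \near y, (F q \o chart_inv p) z + (G q - F q q) = (G \o chart_inv p) z.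
  have H : \forall z \near y, G (chart_inv p z) = F q (chart_inv p z) + (G q - F q q).
    have HGy : \forall r \near chart_inv p y, G r = F q r + (G q - F q q) by rewrite yq; exact: HG.
    exact: chart_inv_continuous py _ HGy.
  by apply: filterS H => z /= ->.
have dFc := is_deriveD (derivableP (diff_derivable dF)) (is_derive_cst (G q - F q q) y _).
split=> [|v].
  apply: near_eq_differentiable nE _; apply: differentiableD => //.
rewrite -(near_eq_derive v nE) -DF.
by have [_ ->] := dFc v; rewrite addr0.
Qed.

End Exact_forms.

(** * Geometry of an isometric immersion *)

Section Linear_algebra.
Context {R : realType}.

Lemma mul_rV_lin1_linear a b (phi : 'rV[R]_a -> 'rV[R]_b) : linear phi ->
  forall u, u *m lin1_mx phi = phi u.
Proof.
move=> lphi u; pose lM := GRing.isLinear.Build _ _ _ _ _ lphi.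
pose L : {linear 'rV[R]_a -> 'rV[R]_b} := HB.pack phi lM.
exact: (mul_rV_lin1 L).
Qed.

Lemma dotrC m (u v : 'rV[R]_m) : dotr u v = dotr v u.
Proof. by rewrite /dotr -[u *m v^T]trmxK trmx_mul trmxK mxE. Qed.

Lemma dotrDl m (u v w : 'rV[R]_m) : dotr (u + v) w = dotr u w + dotr v w.
Proof. by rewrite /dotr mulmxDl mxE. Qed.

Lemma dotrNl m (u w : 'rV[R]_m) : dotr (- u) w = - dotr u w.
Proof. by rewrite /dotr mulNmx mxE. Qed.

Lemma dotrBl m (u v w : 'rV[R]_m) : dotr (u - v) w = dotr u w - dotr v w.
Proof. by rewrite dotrDl dotrNl. Qed.

Lemma dotrDr m (u v w : 'rV[R]_m) : dotr w (u + v) = dotr w u + dotr w v.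
Proof. by rewrite dotrC dotrDl !(dotrC _ w). Qed.

Lemma dotrNr m (u w : 'rV[R]_m) : dotr w (- u) = - dotr w u.
Proof. by rewrite dotrC dotrNl dotrC. Qed.

Lemma dot0r m (u : 'rV[R]_m) : dotr 0 u = 0.
Proof. by rewrite /dotr mul0mx mxE. Qed.

Lemma dotr0 m (u : 'rV[R]_m) : dotr u 0 = 0.
Proof. by rewrite dotrC dot0r. Qed.

Lemma dotr_mulmx a b (A : 'M[R]_(a, b)) u v : dotr (u *m A) v = dotr u (v *m A^T).
Proof. by rewrite /dotr trmx_mul trmxK mulmxA. Qed.

Lemma dotr_delta m (u : 'rV[R]_m) j : dotr u (delta_mx 0 j) = u 0 j.
Proof. by rewrite /dotr trmx_delta -colE mxE. Qed.

Lemma dotr_inj m (u v : 'rV[R]_m) : (forall x, dotr u x = dotr v x) -> u = v.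
Proof. by move=> uv; apply/rowP => j; rewrite -!dotr_delta. Qed.

Lemma dotr_eq0 m (u : 'rV[R]_m) : dotr u u = 0 -> u = 0.
Proof.
rewrite /dotr mxE => /eqP; rewrite psumr_eq0 => [/allP u0|i _]; last by rewrite mxE -expr2 sqr_ge0.
apply/rowP => j; have := u0 j; rewrite mem_index_enum mxE => /(_ isT).
by rewrite mulf_eq0 orbb => /eqP ->; rewrite mxE.
Qed.

(** If u A A^T = 0 then |u A|^2 = 0. *)
Lemma gram_unit a b (A : 'M[R]_(a, b)) : (forall u : 'rV_a, u *m A = 0 -> u = 0) ->
  A *m A^T \in unitmx.
Proof.
move=> injA; rewrite -row_free_unit; apply/inj_row_free => u uG.
by apply: injA; apply: dotr_eq0; rewrite dotr_mulmx -mulmxA uG dotr0.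
Qed.

Lemma mulmx_rV_eq a b (A B : 'M[R]_(a, b)) : (forall x : 'rV_a, x *m A = x *m B) -> A = B.
Proof. by move=> AB; apply/row_matrixP => i; rewrite !rowE AB. Qed.

Lemma skew_trmx a (A : 'M[R]_a) : (forall x y : 'rV_a, dotr (x *m A) y + dotr x (y *m A) = 0) ->
  A^T = - A.
Proof.
move=> skA; apply: mulmx_rV_eq => x; apply: dotr_inj => y.
rewrite dotr_mulmx trmxK mulmxN dotrNl.
by have /eqP := skA x y; rewrite addrC addr_eq0 => /eqP.
Qed.

Lemma dotr_skew a (A : 'M[R]_a) (x y : 'rV_a) : A^T = - A -> dotr (x *m A) y = - dotr x (y *m A).
Proof. by move=> sA; rewrite dotr_mulmx sA mulmxN dotrNr. Qed.

End Linear_algebra.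

(** * Tangential and normal projections along an immersion *)

Section Immersion_projection.
Context {R : realType} {n m : nat} {M : smoothManifold R n}.
Variable f : M -> 'rV[R]_m.
Hypothesis sf : smooth f.
Hypothesis f_inj : forall p, injective (md f p).

Definition jac p : 'M[R]_(n, m) := lin1_mx (md f p).
(* The vector u such that md f p u is the tangential part of x. *)
Definition tanv p (x : 'rV[R]_m) : 'rV[R]_n := x *m (jac p)^T *m invmx (jac p *m (jac p)^T).
Definition tproj p : 'M[R]_m := (jac p)^T *m invmx (jac p *m (jac p)^T) *m jac p.
Definition nproj p : 'M[R]_m := 1%:M - tproj p.

Lemma md_jac p u : md f p u = u *m jac p.
Proof. by rewrite mul_rV_lin1_linear//; exact: md_linear. Qed.

Lemma gram_jac p : jac p *m (jac p)^T \in unitmx.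
Proof.
apply: gram_unit => u uJ; apply: (@f_inj p).
by rewrite !md_jac uJ mul0mx.
Qed.

Lemma md_tanv p x : md f p (tanv p x) = x *m tproj p.
Proof. by rewrite md_jac /tanv /tproj !mulmxA. Qed.

Lemma tanv_md p u : tanv p (md f p u) = u.
Proof. by rewrite /tanv md_jac -(mulmxA u) mulmxK// gram_jac. Qed.

Lemma tanv_linear p : linear (tanv p).
Proof. by move=> a x y; rewrite /tanv !mulmxDl -!scalemxAl. Qed.

Lemma md_tproj p u : md f p u *m tproj p = md f p u.
Proof. by rewrite -md_tanv tanv_md. Qed.

Lemma md_nproj p u : md f p u *m nproj p = 0.
Proof. by rewrite mulmxBr mulmx1 md_tproj subrr. Qed.

Lemma tproj_tr p : (tproj p)^T = tproj p.
Proof.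
by rewrite /tproj !trmx_mul trmxK trmx_inv trmx_mul trmxK mulmxA.
Qed.

Lemma nproj_tr p : (nproj p)^T = nproj p.
Proof. by rewrite /nproj linearB /= trmx1 tproj_tr. Qed.

Lemma tproj_idem p : tproj p *m tproj p = tproj p.
Proof. by apply: mulmx_rV_eq => x; rewrite mulmxA -(md_tanv p x) md_tproj. Qed.

Lemma nproj_idem p : nproj p *m nproj p = nproj p.
Proof. by rewrite {2}/nproj mulmxBr mulmx1 {2}/nproj mulmxBl mul1mx tproj_idem subrr subr0. Qed.

Lemma tnproj p (x : 'rV[R]_m) : x = x *m tproj p + x *m nproj p.
Proof. by rewrite -mulmxDr /nproj addrC subrK mulmx1. Qed.

Lemma normal_vectorP p w : normal_vector f p w <-> w *m nproj p = w.
Proof.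
split=> [nw|wN v].
  rewrite mulmxBr mulmx1 (_ : w *m tproj p = 0) ?subr0//.
  apply: dotr_inj => x; rewrite dot0r dotr_mulmx tproj_tr -md_tanv; exact: nw.
by rewrite -wN dotr_mulmx nproj_tr md_nproj dotr0.
Qed.

Lemma normal_nproj p (x : 'rV[R]_m) : normal_vector f p (x *m nproj p).
Proof. by apply/normal_vectorP; rewrite -mulmxA nproj_idem. Qed.

Lemma normal_nprojK p w : normal_vector f p w -> w *m nproj p = w.
Proof. by move/normal_vectorP. Qed.

Lemma normal_tproj p w : normal_vector f p w -> w *m tproj p = 0.
Proof.
move=> nw; have := tnproj p w; rewrite normal_nprojK// => /eqP.
by rewrite -subr_eq subrr eq_sym => /eqP.
Qed.

Lemma tanv_normal p w : normal_vector f p w -> tanv p w = 0.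
Proof. by move=> nw; apply: (@f_inj p); rewrite md_tanv normal_tproj// md0. Qed.

(** Replaces the choice made in [normal_part] by a matrix product, which is visibly linear and can
    be differentiated in p. *)
Lemma normal_partE p w : normal_part f p w = w *m nproj p.
Proof.
rewrite /normal_part; case: xgetP => [xi _ [nxi [v ->]]|/(_ (w *m nproj p)) []].
  by rewrite mulmxDl md_nproj add0r normal_nprojK.
split; first exact: normal_nproj.
by exists (tanv p w); rewrite md_tanv -tnproj.
Qed.

(** The two transition maps between the chart at p and the chart centred at the point are inverse to
    each other, hence so are their derivatives. *)
Lemma md_chartK (p : M) y u : chart_img p y ->
  md (chart p) (chart_inv p y) ('D_u (chart (chart_inv p y) \o chart_inv p) y) = u.
Proof.
move=> py; set q := chart_inv p y.
have qq := chart_dom_center q.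
have qE : chart_inv q (chart q q) = q by exact: chartK.
have dc : differentiable (chart p \o chart_inv q) (chart q (chart_inv p y)).
  have [H _] := chart_compat q p 1; apply: H; split; first exact: chart_in.
  by rewrite /= -/q qE; exact: chart_inv_in.
have [_ H] := chart_change py qq dc.
rewrite [LHS]/md -(H u).
have nE : \forall z \near y, id z = (chart p \o chart_inv p) z.
  by have := near_chart_img py; apply: filterS => z pz /=; rewrite chart_invK.
by rewrite -(near_eq_derive u nE) derive_id.
Qed.

(* In a chart with Jacobian A of f, the components xi of the field solve
   xi A = tau tproj, and A tproj = A; so xi = tau A^T (A A^T)^-1. *)
Lemma vfield_tanv (tau : M -> 'rV[R]_m) : smooth tau -> vfield (fun q => tanv q (tau q)).
Proof.
move=> st p; have oU : open (chart_img p) := @open_chart_img _ _ M p.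
pose A y : 'M[R]_(n, m) := lin1_mx (fun u => 'D_u (f \o chart_inv p) y).
have lA y : chart_img p y -> linear (fun u => 'D_u (f \o chart_inv p) y).
  by move=> py a u v; have df := smooth_chart_diff sf py; rewrite !deriveE// linearP.
have AE y u : chart_img p y -> u *m A y = 'D_u (f \o chart_inv p) y.
  by move=> py; rewrite mul_rV_lin1_linear//; exact: lA.
have sA : smooth_on (chart_img p) A.
  apply/(smooth_mxP oU) => i j.
  have := smooth_derive (delta_mx 0 i) (sf p) => /(smooth_mxP oU)/(_ 0 j).
  by apply: smooth_on_eq => // y py; rewrite mxE.
have Atan y : chart_img p y -> A y *m tproj (chart_inv p y) = A y.
  move=> py; apply: mulmx_rV_eq => u; rewrite mulmxA AE//.
  by rewrite (derive_md u sf py) md_tproj.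
have uA y : chart_img p y -> A y *m (A y)^T \in unitmx.
  move=> py; apply: gram_unit => u; rewrite AE// (derive_md u sf py) => e.
  rewrite -(md_chartK u py) (_ : 'D_u _ y = 0) ?md0//.
  by apply: (@f_inj (chart_inv p y)); rewrite e md0.
have := smooth_mulmx oU (smooth_mulmx oU (st p) (smooth_trmx oU sA))
  (smooth_invmx oU uA (smooth_mulmx oU sA (smooth_trmx oU sA))).
apply: smooth_on_eq => // y py /=.
set q := chart_inv p y.
have xiA : md (chart p) q (tanv q (tau q)) *m A y = tau q *m tproj q.
  by rewrite AE// -md_tanv (md_derive _ sf (chart_inv_in py)) chart_invK.
have PA : tproj q *m (A y)^T = (A y)^T by rewrite -{1}(tproj_tr q) -trmx_mul Atan.
by rewrite -[RHS](mulmxK (uA y py)) mulmxA xiA -(mulmxA (tau q) (tproj q)) PA.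
Qed.

(** Row b is the image under the differential of f of the tangent field projected from the constant
    vector e_b, a smooth field by [vfield_tanv]. *)
Lemma smooth_tproj : smooth tproj.
Proof.
apply/msmooth_mxP => b c.
have vf := vfield_tanv (@msmooth_cst R n M _ (delta_mx 0 b : 'rV[R]_m)).
have := (msmooth_mxP _).1 (smooth_md_vfield sf vf) 0 c.
by congr smooth; apply/funext => p; rewrite md_tanv -rowE mxE.
Qed.

Lemma smooth_nproj : smooth nproj.
Proof. by apply: msmoothB smooth_tproj; exact: msmooth_cst. Qed.

Lemma normal_section_nproj (eta : M -> 'rV[R]_m) : smooth eta ->
  normal_section f (fun p => eta p *m nproj p).
Proof.
by move=> se; split=> [|p]; [exact: (msmooth_mulmx se smooth_nproj)|exact: normal_nproj].
Qed.

Lemma vfield_at p (u : 'rV[R]_n) : exists X : M -> 'rV[R]_n, vfield X /\ X p = u.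
Proof.
exists (fun q => tanv q (md f p u)); split; last exact: tanv_md.
exact: vfield_tanv (msmooth_cst _).
Qed.

Lemma normal_section_at p w : normal_vector f p w ->
  exists eta, normal_section f eta /\ eta p = w.
Proof.
move=> nw; exists (fun q => w *m nproj q); split; last exact: normal_nprojK.
exact: normal_section_nproj (msmooth_cst _).
Qed.

End Immersion_projection.

(** * Gauss and Weingarten formulas *)

Section Second_fundamental_form.
Context {R : realType} {n m : nat} {M : smoothManifold R n}.
Variables (g : M -> 'rV[R]_n -> 'rV[R]_n -> R)
  (nabla : (M -> 'rV[R]_n) -> (M -> 'rV[R]_n) -> (M -> 'rV[R]_n))
  (f : M -> 'rV[R]_m)
  (alpha : M -> 'rV[R]_n -> 'rV[R]_n -> 'rV[R]_m).
Hypothesis nabla_lc : levi_civita g nabla.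
Hypothesis f_isom : isometric_immersion g f.
Hypothesis alpha_sff : second_fundamental_form nabla f alpha.
Implicit Types (X Y Z W : M -> 'rV[R]_n) (eta : M -> 'rV[R]_m) (p q : M).

Let sf : smooth f. Proof. by case: f_isom. Qed.
Let f_inj p : injective (md f p). Proof. by case: f_isom. Qed.
Let gE p u v : g p u v = dotr (md f p u) (md f p v). Proof. by case: f_isom => _ _ ->. Qed.
Let alpha_t : tensor_TTN f alpha := alpha_sff.1.
Local Notation tanv := (tanv f).
Local Notation tproj := (tproj f).
Local Notation nproj := (nproj f).
Let tn p x : x = md f p (tanv p x) + x *m nproj p.
Proof. by rewrite md_tanv//; exact: tnproj. Qed.

Lemma gauss_formula X Y p : vfield X -> vfield Y ->
  md (fun q => md f q (Y q)) p (X p) = md f p (nabla X Y p) + alpha p (X p) (Y p).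
Proof. by move=> vX vY; exact: alpha_sff.2. Qed.

Lemma g_inj p u v : (forall w, g p u w = g p v w) -> u = v.
Proof.
move=> uv; apply: (@f_inj p); apply/eqP; rewrite -subr_eq0; apply/eqP; apply: dotr_eq0.
by rewrite -mdvB// {1}mdvB// dotrBl -!gE uv subrr.
Qed.

Lemma jac_riesz p (c : 'rV[R]_n) : exists w, forall v, dotr (md f p w) (md f p v) = dotr v c.
Proof.
exists (c *m invmx (jac f p *m (jac f p)^T)) => v.
by rewrite !(md_jac sf) dotrC dotr_mulmx -(mulmxA _ (jac f p)) mulmxKV// gram_jac.
Qed.

(** Nondegeneracy of the induced metric supplies a representing vector, so the default value of
    [xget] is never taken. *)
Lemma shape_opE (gam : M -> 'rV[R]_n -> 'rV[R]_n -> 'rV[R]_m) p (w : 'rV[R]_m) u v :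
  linear (gam p u) -> g p (shape_op g gam p w u) v = dotr (gam p u v) w.
Proof.
move=> lg; move: v; rewrite /shape_op; case: xgetP => [z _ //|].
have [z zE] := jac_riesz p (w *m (lin1_mx (gam p u))^T).
by move=> /(_ z) [] v; rewrite gE zE -dotr_mulmx mul_rV_lin1_linear.
Qed.

(** Torsion-freeness is given for scalar functions; this componentwise version is applied to f, for
    the symmetry of alpha, and to bendings, for the symmetry of their second derivative. *)
Lemma torsion k (F : M -> 'rV[R]_k) X Y p : smooth F -> vfield X -> vfield Y ->
  md F p (nabla X Y p - nabla Y X p) =
  md (fun q => md F q (Y q)) p (X p) - md (fun q => md F q (X q)) p (Y p).
Proof.
move=> sF vX vY; apply/rowP => j; have sFj := (msmooth_mxP _).1 sF 0 j.
rewrite md_mxE// (lc_torsion_free nabla_lc vX vY sFj) !mxE.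
have E W V : vfield W -> vfield V ->
    md (fun q => md (fun r => F r 0 j) q (V q)) p (W p) = md (fun q => md F q (V q)) p (W p) 0 j.
  move=> vW vV; apply: etrans (esym (md_mxE p (W p) 0 j (smooth_md_vfield sF vV))).
  apply: (congr1 (fun H => md H p (W p))); apply/funext => q.
  exact: (esym (md_mxE q (V q) 0 j sF)).
exact: (f_equal2 (fun a b => a - b) (E _ _ vX vY) (E _ _ vY vX)).
Qed.

(** In [torsion] for f the tangential terms of the Gauss formula cancel, leaving the antisymmetric
    part of alpha. *)
Lemma alpha_sym p u v : alpha p u v = alpha p v u.
Proof.
have [X [vX <-]] := vfield_at sf f_inj p u; have [Y [vY <-]] := vfield_at sf f_inj p v.
have := torsion p sf vX vY; rewrite !gauss_formula// mdvB//.
move: (md f p _) (md f p _) (alpha p _ _) (alpha p _ _) => a b c d.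
rewrite opprD addrACA => /eqP; rewrite -subr_eq0 opprD addrA subrr sub0r oppr_eq0 subr_eq0.
by move=> /eqP.
Qed.

Lemma md_dotr (F G : M -> 'rV[R]_m) p v : smooth F -> smooth G ->
  md (fun q => dotr (F q) (G q)) p v = dotr (md F p v) (G p) + dotr (F p) (md G p v).
Proof.
move=> sF sG; have sGt := msmooth_trmx sG.
rewrite /dotr -(md_mxE p v 0 0 (msmooth_mulmx sF sGt)) md_mulmx// md_trmx//.
by rewrite mxE.
Qed.

(** Differentiate <F, f_* Y> = 0 along X; the Gauss formula for f_* Y leaves only alpha against F.
    This yields the Weingarten formula [tanv_derive_normal]. *)
Lemma normal_derive X Y (F : M -> 'rV[R]_m) p : smooth F -> (forall q, normal_vector f q (F q)) ->
  vfield X -> vfield Y ->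
  dotr (md F p (X p)) (md f p (Y p)) = - dotr (F p) (alpha p (X p) (Y p)).
Proof.
move=> sF nF vX vY.
have E : (fun q => dotr (F q) (md f q (Y q))) = (fun=> 0) by apply/funext => q; exact: nF.
have := md_dotr p (X p) sF (smooth_md_vfield sf vY).
rewrite E md_cst gauss_formula// dotrDr nF add0r.
by move/esym/eqP; rewrite addr_eq0 => /eqP.
Qed.

Lemma tanv_derive_normal X eta p : vfield X -> normal_section f eta ->
  tanv p (md eta p (X p)) = - shape_op g alpha p (eta p) (X p).
Proof.
move=> vX [se ne]; apply: (@g_inj p) => v; have [V [vV <-]] := vfield_at sf f_inj p v.
rewrite gE md_tanv// dotr_mulmx tproj_tr md_tproj// normal_derive//.
rewrite gE mdvN// dotrNl -gE shape_opE; last exact: ttn_linearr alpha_t _ _.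
by rewrite dotrC.
Qed.

(** The normal-to-tangent block of a skew matrix is minus the transpose of its tangent-to-normal
    block, so three of the four blocks suffice. *)
Lemma skew_eq0 p (A : 'M[R]_m) : A^T = - A -> (forall u, md f p u *m A = 0) ->
  (forall w, normal_vector f p w -> w *m A *m nproj p = 0) -> A = 0.
Proof.
move=> sA tA nA; apply: mulmx_rV_eq => x; rewrite mulmx0 (tn p x) mulmxDl tA add0r.
have nx := normal_nproj sf f_inj p x; move: (x *m _) nx => w nw.
apply: dotr_inj => y; rewrite dot0r (tn p y) dotrDr dotr_skew// tA dotr0 oppr0 add0r.
by rewrite -(nproj_tr f p) -dotr_mulmx nA// dot0r.
Qed.

End Second_fundamental_form.

(** * The associated pair in terms of a rotation field *)

Section Bending_pair.
Context {R : realType} {n m : nat} {M : smoothManifold R n}.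
Variables (g : M -> 'rV[R]_n -> 'rV[R]_n -> R)
  (nabla : (M -> 'rV[R]_n) -> (M -> 'rV[R]_n) -> (M -> 'rV[R]_n))
  (f : M -> 'rV[R]_m)
  (alpha : M -> 'rV[R]_n -> 'rV[R]_n -> 'rV[R]_m).
Hypothesis f_isom : isometric_immersion g f.
Hypothesis alpha_sff : second_fundamental_form nabla f alpha.
Implicit Types (X Y Z W : M -> 'rV[R]_n) (eta : M -> 'rV[R]_m) (p q : M).

Let sf : smooth f. Proof. by case: f_isom. Qed.
Let f_inj p : injective (md f p). Proof. by case: f_isom. Qed.
Let alpha_t : tensor_TTN f alpha := alpha_sff.1.
Local Notation tanv := (tanv f).
Local Notation nproj := (nproj f).
Let tn p x : x = md f p (tanv p x) + x *m nproj p.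
Proof. by rewrite md_tanv//; exact: tnproj. Qed.

Variables (T : M -> 'rV[R]_m) (D : M -> 'M[R]_m).
Hypothesis sD : smooth D.
Hypothesis D_skew : forall p, (D p)^T = - D p.
Hypothesis TD : forall p u, md T p u = md f p u *m D p.

Let C p (w : 'rV[R]_m) := w *m D p *m nproj p.

(** The left side is the tensor B(X, Y) of the bending, before its normal part is taken. *)
Lemma derive_bending X Y p : vfield X -> vfield Y ->
  md (fun q => md T q (Y q)) p (X p) - md T p (nabla X Y p) =
  alpha p (X p) (Y p) *m D p + md f p (Y p) *m md D p (X p).
Proof.
move=> vX vY.
have -> : (fun q => md T q (Y q)) = (fun q => md f q (Y q) *m D q) by apply/funext => q; exact: TD.
rewrite (md_mulmx p (X p) (smooth_md_vfield sf vY) sD) (gauss_formula alpha_sff p vX vY).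
rewrite (TD p (nabla X Y p)) (mulmxDl (md f p (nabla X Y p))).
by move: (md f p (nabla X Y p) *m D p) => a; rewrite -(addrA a) [LHS]addrC addKr.
Qed.

Lemma assoc_betaE X Y p : vfield X -> vfield Y ->
  assoc_beta nabla f T X Y p =
  C p (alpha p (X p) (Y p)) + md f p (Y p) *m md D p (X p) *m nproj p.
Proof.
move=> vX vY; rewrite /assoc_beta (normal_partE sf f_inj) derive_bending//.
by rewrite mulmxDl.
Qed.

(** By skewness, D moves from f_* v to w in the defining equation of [bending_Y]. *)
Lemma bending_YE p w : bending_Y f T p w = tanv p (w *m D p).
Proof.
have spec v : dotr (md f p (tanv p (w *m D p))) (md f p v) + dotr w (md T p v) = 0.
  rewrite (md_tanv sf p) dotr_mulmx (tproj_tr f p) (md_tproj sf f_inj) TD.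
  by rewrite (dotr_skew _ _ (D_skew p)) addNr.
rewrite /bending_Y; case: xgetP => [z _ zE|/(_ (tanv p (w *m D p)))/(_ spec)//].
apply: (g_inj f_isom (p := p)) => v; case: f_isom => _ _ gE; rewrite -!gE.
exact: (addIr (dotr w (md T p v)) (etrans (zE v) (esym (spec v)))).
Qed.

Lemma skew_endo_nproj : skew_endo f C.
Proof.
split=> [p a w z _ _|p w _|eta [se ne]|p w z nw nz].
- by rewrite /C !mulmxDl -!scalemxAl.
- exact: (normal_nproj sf f_inj).
- apply: msmooth_mulmx; last exact: (smooth_nproj sf f_inj).
  exact: msmooth_mulmx.
have dN x y : dotr (x *m nproj p) y = dotr x (y *m nproj p) by rewrite dotr_mulmx nproj_tr.
rewrite /C dN (normal_nprojK sf f_inj nz) -(dN w) (normal_nprojK sf f_inj nw).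
by rewrite (dotr_skew _ _ (D_skew p)) addNr.
Qed.

(** Split eta D into f_* W plus C eta, where W is the value of [bending_Y] at eta, and compare the
    normal parts of the derivatives of both sides. The Gauss formula for f_* W gives alpha(X, W),
    while the tangential part - A_eta X of the derivative of eta gives the term with L A_eta X. *)
Lemma assoc_EE X eta p : vfield X -> normal_section f eta ->
  assoc_E g f alpha T p (X p) (eta p) =
  eta p *m md D p (X p) *m nproj p - covder_NN f C X eta p.
Proof.
move=> vX neta; have [se ne] := neta.
pose W q := tanv q (eta q *m D q).
have seD : smooth (fun q => eta q *m D q) by exact: msmooth_mulmx.
have vW : vfield W by exact: (vfield_tanv sf f_inj seD).
rewrite /assoc_E bending_YE -/(W p) (normal_partE sf f_inj) TD.
have -> : covder_NN f C X eta p = (md eta p (X p) *m D p + eta p *m md D p (X p)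
    - md f p (nabla X W p) - alpha p (X p) (W p)) *m nproj p
    - md eta p (X p) *m nproj p *m D p *m nproj p.
  rewrite /covder_NN /normal_conn !(normal_partE sf f_inj) {2}/C; congr (_ *m _ - _).
  have -> : (fun q => C q (eta q)) = (fun q => eta q *m D q - md f q (W q)).
    by apply/funext => q; rewrite /C {2}(tn q (eta q *m D q)) addrC addKr.
  rewrite (mdB p (X p) seD (smooth_md_vfield sf vW)) (md_mulmx p (X p) se sD).
  by rewrite (gauss_formula alpha_sff p vX vW) opprD addrA.
have AD : md eta p (X p) *m D p =
    - (md f p (shape_op g alpha p (eta p) (X p)) *m D p) + md eta p (X p) *m nproj p *m D p.
  rewrite {1}(tn p (md eta p (X p))) (tanv_derive_normal f_isom alpha_sff p vX neta).
  by rewrite (mdvN _ _ sf) mulmxDl mulNmx.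
have JN := md_nproj sf f_inj p (nabla X W p).
have aN := normal_nprojK sf f_inj (ttn_normal alpha_t p (X p) (W p)).
move: AD JN aN; move: (md eta p (X p)) (md f p (nabla X W p)) => A B.
move: (md f p (shape_op g alpha p (eta p) (X p))) (alpha p (X p) (W p)) (md D p (X p)) => b a d.
move=> AD BN aN; rewrite AD !mulmxBl !mulmxDl mulNmx BN subr0 aN.
by apply/rowP => j; rewrite !mxE; ring.
Qed.

End Bending_pair.

(** * The closed one-form attached to a pair *)

Section Connection_form.
Context {R : realType} {n m : nat} {M : smoothManifold R n}.
Variables (g : M -> 'rV[R]_n -> 'rV[R]_n -> R)
  (nabla : (M -> 'rV[R]_n) -> (M -> 'rV[R]_n) -> (M -> 'rV[R]_n))
  (f : M -> 'rV[R]_m)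
  (alpha beta : M -> 'rV[R]_n -> 'rV[R]_n -> 'rV[R]_m)
  (E : M -> 'rV[R]_n -> 'rV[R]_m -> 'rV[R]_m).
Hypothesis nabla_lc : levi_civita g nabla.
Hypothesis f_isom : isometric_immersion g f.
Hypothesis alpha_sff : second_fundamental_form nabla f alpha.
Hypothesis beta_tensor : tensor_TTN f beta.
Hypothesis beta_sym : forall p u v, beta p u v = beta p v u.
Hypothesis E_tensor : tensor_TNN f E.
Hypothesis E_skew : forall X eta xi,
    vfield X -> normal_section f eta -> normal_section f xi -> forall p,
    dotr (E p (X p) (eta p)) (xi p) + dotr (E p (X p) (xi p)) (eta p) = 0.
Implicit Types (X Y Z W : M -> 'rV[R]_n) (eta : M -> 'rV[R]_m) (p q : M).

Let sf : smooth f. Proof. by case: f_isom. Qed.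
Let f_inj p : injective (md f p). Proof. by case: f_isom. Qed.
Let alpha_t : tensor_TTN f alpha := alpha_sff.1.
Local Notation tanv := (tanv f).
Local Notation nproj := (nproj f).
Let tn p x : x = md f p (tanv p x) + x *m nproj p.
Proof. by rewrite (md_tanv sf)//; exact: tnproj. Qed.

Let nnp p x : normal_vector f p (x *m nproj p). Proof. exact: normal_nproj. Qed.
Let nK p w : normal_vector f p w -> w *m nproj p = w. Proof. exact: normal_nprojK. Qed.
(* Row-vector convention: Omega p u acts by x |-> x *m Omega p u.  The transpose of
   beta_mx carries the operator B of the pair. *)
Definition beta_mx p u : 'M[R]_m := lin1_mx (fun x => beta p u (tanv p x)).
Definition E_mx p u : 'M[R]_m := lin1_mx (fun x => E p u (x *m nproj p)).
Definition Omega p u : 'M[R]_m := beta_mx p u - (beta_mx p u)^T + E_mx p u.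

Lemma beta_mxE p u x : x *m beta_mx p u = beta p u (tanv p x).
Proof.
rewrite mul_rV_lin1_linear// => a y z.
by rewrite (tanv_linear f p a y z) (ttn_linearr beta_tensor).
Qed.

Lemma E_mxE p u x : x *m E_mx p u = E p u (x *m nproj p).
Proof.
rewrite mul_rV_lin1_linear// => a y z.
by rewrite mulmxDl -scalemxAl (tnn_linearr E_tensor).
Qed.

Let E0 p u : E p u 0 = 0.
Proof. by have := E_mxE p u 0; rewrite !mul0mx. Qed.

Let betar0 p u : beta p u 0 = 0.
Proof. by have := ttn_linearr beta_tensor p u (-1) 0 0; rewrite scaler0 add0r scaleN1r addNr. Qed.

Lemma nproj_beta_mx p u : nproj p *m beta_mx p u = 0.
Proof.
apply: mulmx_rV_eq => x; rewrite mulmx0 mulmxA beta_mxE.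
by rewrite (tanv_normal sf f_inj (nnp _ _)) betar0.
Qed.

Lemma E_pointwise_skew p u w z : normal_vector f p w -> normal_vector f p z ->
  dotr (E p u w) z + dotr (E p u z) w = 0.
Proof.
move=> nw nz; have [X [vX <-]] := vfield_at sf f_inj p u.
have [eta [ne <-]] := normal_section_at sf f_inj nw.
have [xi [nx <-]] := normal_section_at sf f_inj nz.
exact: E_skew.
Qed.

Let dN p x y : dotr (x *m nproj p) y = dotr x (y *m nproj p).
Proof. by rewrite dotr_mulmx nproj_tr. Qed.

Lemma E_mx_skew p u : (E_mx p u)^T = - E_mx p u.
Proof.
apply: skew_trmx => x y; rewrite !E_mxE.
have nx : E p u (x *m nproj p) *m nproj p = E p u (x *m nproj p).
  by apply: nK; exact: (tnn_normal E_tensor).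
have ny : E p u (y *m nproj p) *m nproj p = E p u (y *m nproj p).
  by apply: nK; exact: (tnn_normal E_tensor).
rewrite -nx -ny dN -(dN p x) [dotr (x *m _) _]dotrC.
exact: E_pointwise_skew.
Qed.

Lemma Omega_skew p u : (Omega p u)^T = - Omega p u.
Proof. by rewrite /Omega linearD linearB /= trmxK E_mx_skew !opprD opprK [X in X - _]addrC. Qed.

Lemma Omega_md p u v : md f p v *m Omega p u = beta p u v.
Proof.
rewrite /Omega mulmxDr mulmxBr beta_mxE (tanv_md sf f_inj) E_mxE (md_nproj sf f_inj) E0 addr0.
rewrite (_ : _ *m _^T = 0) ?subr0//.
apply: dotr_inj => x; rewrite dot0r dotr_mulmx trmxK beta_mxE dotrC.
exact: (ttn_normal beta_tensor).
Qed.

Lemma Omega_normal p u w : normal_vector f p w -> w *m Omega p u *m nproj p = E p u w.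
Proof.
move=> nw; rewrite /Omega (mulmxDr w) (mulmxBr w) beta_mxE (tanv_normal sf f_inj nw) betar0 sub0r.
rewrite E_mxE (nK nw) mulmxDl (nK (tnn_normal E_tensor u nw)).
have bN : (beta_mx p u)^T *m nproj p = 0.
  by rewrite -(nproj_tr f p) -trmx_mul nproj_beta_mx trmx0.
by rewrite mulNmx -mulmxA bN mulmx0 oppr0 add0r.
Qed.

Lemma Omega_linear p a u v : Omega p (a *: u + v) = a *: Omega p u + Omega p v.
Proof.
have bl : beta_mx p (a *: u + v) = a *: beta_mx p u + beta_mx p v.
  apply: mulmx_rV_eq => x; rewrite mulmxDr -scalemxAr !beta_mxE.
  exact: (ttn_linearl beta_tensor).
have El : E_mx p (a *: u + v) = a *: E_mx p u + E_mx p v.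
  apply: mulmx_rV_eq => x; rewrite mulmxDr -scalemxAr !E_mxE.
  exact: (tnn_linearl E_tensor (nnp _ _)).
rewrite /Omega bl El; move: (beta_mx p u) (beta_mx p v) (E_mx p u) (E_mx p v) => b c d e.
by apply/matrixP => i j; rewrite !mxE; ring.
Qed.

Lemma OmegaD p u v : Omega p (u + v) = Omega p u + Omega p v.
Proof. by have := Omega_linear p 1 u v; rewrite !scale1r. Qed.

Lemma Omega0 p : Omega p 0 = 0.
Proof. by have := Omega_linear p (-1) 0 0; rewrite scaler0 add0r scaleN1r addNr. Qed.

Lemma OmegaZ p a u : Omega p (a *: u) = a *: Omega p u.
Proof. by have := Omega_linear p a u 0; rewrite Omega0 !addr0. Qed.

Lemma OmegaB p u v : Omega p (u - v) = Omega p u - Omega p v.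
Proof. by rewrite OmegaD -scaleN1r OmegaZ scaleN1r. Qed.

Lemma smooth_Omega X : vfield X -> smooth (fun p => Omega p (X p)).
Proof.
move=> vX.
have sb : smooth (fun p => beta_mx p (X p)).
  apply/msmooth_mxP => i j.
  have vf := vfield_tanv sf f_inj (@msmooth_cst R n M _ (delta_mx 0 i : 'rV[R]_m)).
  have := (msmooth_mxP _).1 (ttn_smooth beta_tensor vX vf) 0 j.
  by congr smooth; apply/funext => p; rewrite -beta_mxE -rowE mxE.
have sE : smooth (fun p => E_mx p (X p)).
  apply/msmooth_mxP => i j.
  have ns := normal_section_nproj sf f_inj (@msmooth_cst R n M _ (delta_mx 0 i : 'rV[R]_m)).
  have := (msmooth_mxP _).1 (tnn_smooth E_tensor vX ns) 0 j.
  by congr smooth; apply/funext => p; rewrite -E_mxE -rowE mxE.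
by apply: msmoothD => //; apply: msmoothB => //; exact: msmooth_trmx.
Qed.

Hypothesis gauss_eq : forall X Y Z, vfield X -> vfield Y -> vfield Z -> forall p,
    shape_op g alpha p (beta p (Y p) (Z p)) (X p)
      + shape_op g beta p (alpha p (Y p) (Z p)) (X p)
    = shape_op g alpha p (beta p (X p) (Z p)) (Y p)
      + shape_op g beta p (alpha p (X p) (Z p)) (Y p).
Hypothesis codazzi_eq : forall X Y Z, vfield X -> vfield Y -> vfield Z -> forall p,
    covder_TTN nabla f beta X Y Z p - covder_TTN nabla f beta Y X Z p
    = E p (Y p) (alpha p (X p) (Z p)) - E p (X p) (alpha p (Y p) (Z p)).
Hypothesis ricci_eq : forall X Y eta, vfield X -> vfield Y -> normal_section f eta ->
    forall p,
    covder_TNN nabla f E X Y eta p - covder_TNN nabla f E Y X eta p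
    = beta p (X p) (shape_op g alpha p (eta p) (Y p))
      - beta p (shape_op g alpha p (eta p) (X p)) (Y p)
      + alpha p (X p) (shape_op g beta p (eta p) (Y p))
      - alpha p (shape_op g beta p (eta p) (X p)) (Y p).

(** Leibniz rule for the product of f_* Z with Omega(Y), which is beta(Y, Z); the Gauss formula for
    f_* Z produces the last two terms. *)
Lemma derive_Omega_md X Y Z p : vfield X -> vfield Y -> vfield Z ->
  md f p (Z p) *m md (fun q => Omega q (Y q)) p (X p) =
  md (fun q => beta q (Y q) (Z q)) p (X p) - beta p (Y p) (nabla X Z p)
  - alpha p (X p) (Z p) *m Omega p (Y p).
Proof.
move=> vX vY vZ.
have <- : (fun q => md f q (Z q) *m Omega q (Y q)) = (fun q => beta q (Y q) (Z q)).
  by apply/funext => q; exact: Omega_md.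
rewrite (md_mulmx p (X p) (smooth_md_vfield sf vZ) (smooth_Omega vY)).
rewrite (gauss_formula alpha_sff p vX vZ) mulmxDl Omega_md.
move: (md f p (Z p) *m _) (alpha p _ _ *m _) (beta p _ _) => a b c.
by apply/rowP => j; rewrite !mxE; ring.
Qed.

(* The exterior derivative of Omega evaluated on X and Y. *)
Let Theta X Y p := md (fun q => Omega q (Y q)) p (X p) - md (fun q => Omega q (X q)) p (Y p)
  - Omega p (nabla X Y p - nabla Y X p).

Lemma Theta_skew X Y p : vfield X -> vfield Y -> (Theta X Y p)^T = - Theta X Y p.
Proof.
move=> vX vY.
have H Z W : vfield Z ->
    (md (fun q => Omega q (Z q)) p (W p))^T = - md (fun q => Omega q (Z q)) p (W p).
  move=> vZ; rewrite -(md_trmx p (W p) (smooth_Omega vZ)) -(mdN p (W p) (smooth_Omega vZ)).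
  by apply: (congr1 (fun F => md F p (W p))); apply/funext => q; exact: Omega_skew.
rewrite /Theta !linearB /= Omega_skew (H Y X vY) (H X Y vX).
move: (md _ p (X p)) (md _ p (Y p)) (Omega p _) => a b c.
by apply/matrixP => i j; rewrite !mxE; ring.
Qed.

(** The second equation: the derivatives of beta become normal covariant derivatives, and Omega(Y)
    acting on alpha(X, Z) has normal part E(Y, alpha(X, Z)). *)
Lemma Theta_tangent_normal X Y Z p : vfield X -> vfield Y -> vfield Z ->
  md f p (Z p) *m Theta X Y p *m nproj p = 0.
Proof.
move=> vX vY vZ; rewrite /Theta OmegaB !(mulmxBr (md f p (Z p))) !Omega_md.
rewrite (derive_Omega_md p vX vY vZ) (derive_Omega_md p vY vX vZ).
rewrite !mulmxBl !(Omega_normal _ (ttn_normal alpha_t _ _ _)) !(nK (ttn_normal beta_tensor _ _ _)).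
have := codazzi_eq vX vY vZ p; rewrite /covder_TTN /normal_conn !(normal_partE sf f_inj).
move: (md _ p (X p) *m _) (md _ p (Y p) *m _)
  (beta p (Y p) (nabla X Z p)) (beta p (X p) (nabla Y Z p)) (beta p (nabla X Y p) (Z p)) (beta p (nabla Y X p) (Z p))
  (E p (Y p) _) (E p (X p) _) => a b c d e e' h k H.
apply/rowP => j; have := congr1 (fun x : 'rV[R]_m => x 0 j) H; rewrite !mxE; lra.
Qed.

(** The first equation, paired with V: the derivative of the normal field beta(Y, Z) along X has
    tangential part - A_beta(Y,Z) X, and Omega(Y) acting on alpha(X, Z) has tangential part -
    B_alpha(X,Z) Y. *)
Lemma Theta_tangent_tangent X Y Z V p : vfield X -> vfield Y -> vfield Z -> vfield V ->
  dotr (md f p (Z p) *m Theta X Y p) (md f p (V p)) = 0.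
Proof.
move=> vX vY vZ vV; rewrite /Theta OmegaB !(mulmxBr (md f p (Z p))) !Omega_md.
rewrite (derive_Omega_md p vX vY vZ) (derive_Omega_md p vY vX vZ).
rewrite !dotrBl !(ttn_normal beta_tensor _ _ _ (V p)).
have nb A B q : normal_vector f q (beta q (A q) (B q)) by exact: (ttn_normal beta_tensor).
rewrite (normal_derive f_isom alpha_sff p (ttn_smooth beta_tensor vY vZ) (nb Y Z) vX vV).
rewrite (normal_derive f_isom alpha_sff p (ttn_smooth beta_tensor vX vZ) (nb X Z) vY vV).
rewrite !(dotr_skew _ _ (Omega_skew p _)) !Omega_md.
have := congr1 (fun w => g p w (V p)) (gauss_eq vX vY vZ p).
have gD u v w : g p (u + v) w = g p u w + g p v w.
  by case: f_isom => _ _ gE; rewrite -!gE mdvD// dotrDl.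
rewrite /= !gD !(shape_opE f_isom); try exact: (ttn_linearr alpha_t);
  try exact: (ttn_linearr beta_tensor).
rewrite [dotr (alpha p (X p) (V p)) _]dotrC [dotr (beta p (X p) (V p)) _]dotrC.
rewrite [dotr (alpha p (Y p) (V p)) _]dotrC [dotr (beta p (Y p) (V p)) _]dotrC.
move: (dotr (beta p (Y p) (Z p)) _) (dotr (alpha p (Y p) (Z p)) _)
  (dotr (beta p (X p) (Z p)) _) (dotr (alpha p (X p) (Z p)) _).
move=> a b c d; lra.
Qed.

(** Omega(Y) eta has tangential part - B_eta Y and normal part E(Y, eta). In the normal part of its
    derivative the former contributes through alpha; the tangential part - A_eta X of the derivative
    of eta contributes through beta. *)
Lemma derive_Omega_normal X Y eta p : vfield X -> vfield Y -> normal_section f eta ->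
  eta p *m md (fun q => Omega q (Y q)) p (X p) *m nproj p =
  normal_conn f X (fun q => E q (Y q) (eta q)) p - E p (Y p) (normal_conn f X eta p)
  - alpha p (X p) (shape_op g beta p (eta p) (Y p))
  + beta p (Y p) (shape_op g alpha p (eta p) (X p)).
Proof.
move=> vX vY neta; have [se ne] := neta.
have sO := smooth_Omega vY.
have seO : smooth (fun q => eta q *m Omega q (Y q)) by exact: msmooth_mulmx.
pose W q := tanv q (eta q *m Omega q (Y q)).
have vW : vfield W by exact: (vfield_tanv sf f_inj seO).
have sE : smooth (fun q => E q (Y q) (eta q)) := tnn_smooth E_tensor vY neta.
have WE : W p = - shape_op g beta p (eta p) (Y p).
  apply: (g_inj f_isom (p := p)) => v; case: (f_isom) => _ _ gE.
  have -> : g p (- shape_op g beta p (eta p) (Y p)) v = - g p (shape_op g beta p (eta p) (Y p)) v.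
    by rewrite -!gE (mdvN _ _ sf) dotrNl.
  rewrite (shape_opE f_isom); last exact: (ttn_linearr beta_tensor).
  rewrite -gE (md_tanv sf) dotr_mulmx (tproj_tr f p) (md_tproj sf f_inj).
  by rewrite (dotr_skew _ _ (Omega_skew _ _)) Omega_md dotrC.
have AE := tanv_derive_normal f_isom alpha_sff p vX neta.
have tnA := tn p (md eta p (X p)).
have split_eO : (fun q => eta q *m Omega q (Y q)) = (fun q => md f q (W q) + E q (Y q) (eta q)).
  by apply/funext => q; rewrite {1}(tn q (eta q *m Omega q (Y q))) Omega_normal.
have := congr1 (fun F => md F p (X p)) split_eO.
rewrite /= (md_mulmx p (X p) se sO) (mdD p (X p) (smooth_md_vfield sf vW) sE).
have AO : md eta p (X p) *m Omega p (Y p) =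
    - beta p (Y p) (shape_op g alpha p (eta p) (X p)) + md eta p (X p) *m nproj p *m Omega p (Y p).
  by rewrite {1}tnA AE (mdvN _ _ sf) mulmxDl mulNmx Omega_md.
have aN : alpha p (X p) (W p) = - alpha p (X p) (shape_op g beta p (eta p) (Y p)).
  have := ttn_linearr alpha_t p (X p) (-1) (shape_op g beta p (eta p) (Y p)) 0.
  have := ttn_linearr alpha_t p (X p) (-1) 0 0; rewrite scaler0 add0r scaleN1r addNr => ->.
  by rewrite WE !addr0 !scaleN1r.
rewrite (gauss_formula alpha_sff p vX vW) AO aN => /(congr1 (fun x => x *m nproj p)).
rewrite /normal_conn !(normal_partE sf f_inj) /= !mulmxDl !mulNmx.
rewrite (Omega_normal (Y p) (nnp p (md eta p (X p)))) (md_nproj sf f_inj p (nabla X W p)).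
rewrite (nK (ttn_normal beta_tensor _ _ _)) (nK (ttn_normal alpha_t _ _ _)).
move: (eta p *m _ *m _) (md _ p (X p) *m _) (beta p _ _) (alpha p _ _) (E p _ _) => a b c d e H.
by apply/rowP => j; have := congr1 (fun x : 'rV[R]_m => x 0 j) H; rewrite !mxE; lra.
Qed.

(** The third equation, once the symmetry of alpha and beta has brought the shape operators into the
    second argument. *)
Lemma Theta_normal_normal X Y eta p : vfield X -> vfield Y -> normal_section f eta ->
  eta p *m Theta X Y p *m nproj p = 0.
Proof.
move=> vX vY neta; have [_ ne] := neta; rewrite /Theta OmegaB !(mulmxBr (eta p)) !mulmxBl.
rewrite (derive_Omega_normal p vX vY neta) (derive_Omega_normal p vY vX neta).
rewrite !(Omega_normal _ (ne p)).
have := ricci_eq vX vY neta p; rewrite /covder_TNN.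
rewrite (beta_sym p (shape_op _ _ _ _ _)).
rewrite (alpha_sym nabla_lc f_isom alpha_sff p (shape_op _ _ _ _ _)).
move: (normal_conn f X _ p) (normal_conn f Y _ p) (E p (nabla X Y p) _) (E p (nabla Y X p) _)
  (E p (X p) _) (E p (Y p) _) => a b c d e h.
move: (beta p (X p) _) (beta p (Y p) _) (alpha p (X p) _) (alpha p (Y p) _) => k l r s H.
by apply/rowP => j; have := congr1 (fun x : 'rV[R]_m => x 0 j) H; rewrite !mxE; lra.
Qed.

Lemma Theta_eq0 X Y p : vfield X -> vfield Y -> Theta X Y p = 0.
Proof.
move=> vX vY; apply: (skew_eq0 f_isom (p := p) (Theta_skew p vX vY)) => [u|w nw].
  have [Z [vZ <-]] := vfield_at sf f_inj p u.
  apply: dotr_inj => y; rewrite dot0r (tn p y) dotrDr -(nproj_tr f p) -dotr_mulmx.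
  rewrite (Theta_tangent_normal p vX vY vZ) dot0r addr0.
  have [V [vV <-]] := vfield_at sf f_inj p (tanv p y).
  exact: Theta_tangent_tangent.
by have [eta [neta <-]] := normal_section_at sf f_inj nw; exact: Theta_normal_normal.
Qed.

(** As u is recovered from f_* u by [tanv], the entry (b, c) of Omega is the sum of the w_a df_a,
    with w_a its value on the projection of the a-th basis vector of R^m. *)
Let w a b c q : R := Omega q (tanv q (delta_mx 0 a)) b c.

Let sw a b c : smooth (w a b c).
Proof.
have vf := vfield_tanv sf f_inj (@msmooth_cst R n M _ (delta_mx 0 a : 'rV[R]_m)).
exact: ((msmooth_mxP _).1 (smooth_Omega vf) b c).
Qed.

Let sfa a : smooth (fun q => f q 0 a).
Proof. exact: ((msmooth_mxP _).1 sf 0 a). Qed.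

Lemma Omega_sum b c q (x : 'rV[R]_m) : \sum_a w a b c q * x 0 a = Omega q (tanv q x) b c.
Proof.
have -> : Omega q (tanv q x) = \sum_a x 0 a *: Omega q (tanv q (delta_mx 0 a)).
  rewrite {1}(row_sum_delta x).
  elim/big_ind2: _ => [|y1 y2 z1 z2 e1 e2|a _].
  - by rewrite /tanv !mul0mx Omega0.
  - by rewrite /tanv !mulmxDl OmegaD -e1 -e2.
  - by rewrite /tanv -!scalemxAl OmegaZ.
by rewrite summxE; apply: eq_bigr => a _; rewrite mxE mulrC.
Qed.

(** Differentiate the expression of Omega(Y) by the coefficients [w] along X. The terms in which f_*
    Y is differentiated add up to the entry of Omega at nabla_X Y, since [tanv] kills alpha;
    antisymmetrizing what remains gives the entry of [Theta], which is zero. *)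
Lemma Omega_closed b c q u v :
  \sum_a md (w a b c) q u * md (fun r => f r 0 a) q v =
  \sum_a md (w a b c) q v * md (fun r => f r 0 a) q u.
Proof.
suff H X Y : vfield X -> vfield Y ->
    \sum_a md (w a b c) q (X q) * md (fun r => f r 0 a) q (Y q) =
    (md (fun r => Omega r (Y r)) q (X q) - Omega q (nabla X Y q)) b c.
  have [X [vX <-]] := vfield_at sf f_inj q u; have [Y [vY <-]] := vfield_at sf f_inj q v.
  rewrite !H//; have := Theta_eq0 q vX vY; rewrite /Theta OmegaB.
  move: (md _ q (X q)) (md _ q (Y q)) (Omega q _) (Omega q _) => A B A' B' /matrixP/(_ b c).
  by rewrite !mxE; lra.
move=> vX vY.
have sJ a : smooth (fun r => md f r (Y r) 0 a).
  exact: ((msmooth_mxP _).1 (smooth_md_vfield sf vY) 0 a).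
have E1 : md (fun r => Omega r (Y r)) q (X q) b c =
   \sum_a (md (w a b c) q (X q) * md f q (Y q) 0 a +
     w a b c q * md (fun r => md f r (Y r)) q (X q) 0 a).
  rewrite (md_mxE _ _ _ _ (smooth_Omega vY)).
  have -> : (fun r => Omega r (Y r) b c) = (fun r => \sum_a w a b c r * md f r (Y r) 0 a).
    by apply/funext => r; rewrite Omega_sum (tanv_md sf f_inj).
  rewrite md_sum; last by move=> a; exact: msmoothM.
  apply: eq_bigr => a _; rewrite (mdM q (X q) (sw a b c) (sJ a)).
  by rewrite (md_mxE _ _ _ _ (smooth_md_vfield sf vY)).
have E2 : Omega q (nabla X Y q) b c = \sum_a w a b c q * md (fun r => md f r (Y r)) q (X q) 0 a.
  rewrite Omega_sum (gauss_formula alpha_sff q vX vY).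
  have -> : tanv q (md f q (nabla X Y q) + alpha q (X q) (Y q)) = nabla X Y q; last by [].
  have := tanv_linear f q 1 (md f q (nabla X Y q)) (alpha q (X q) (Y q)); rewrite !scale1r => ->.
  by rewrite (tanv_md sf f_inj) (tanv_normal sf f_inj (ttn_normal alpha_t _ _ _)) addr0.
rewrite mxE [X in _ + X]mxE E1 E2 big_split /= addrK.
by apply: eq_bigr => a _; rewrite (md_mxE _ _ _ _ sf).
Qed.

Lemma Omega_primitive (M_sc : simply_connected R M) : exists D : M -> 'M[R]_m,
  [/\ smooth D, forall p, (D p)^T = - D p & forall p u, md D p u = Omega p u].
Proof.
have ex (bc : 'I_m * 'I_m) : exists F : M -> R, smooth F /\
    forall q v, md F q v = \sum_a w a bc.1 bc.2 q * md (fun r => f r 0 a) q v.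
  exact: (@exact_form _ _ _ _ (fun a => w a bc.1 bc.2) (fun a r => f r 0 a)
    (fun a => @sw a _ _) sfa (Omega_closed _ _) M_sc).
have [F HF] := choice ex.
pose D0 p : 'M[R]_m := \matrix_(b, c) F (b, c) p.
have sD0 : smooth D0.
  apply/msmooth_mxP => b c; have [+ _] := HF (b, c).
  by congr smooth; apply/funext => p; rewrite mxE.
have dD0 p u : md D0 p u = Omega p u.
  apply/matrixP => b c; rewrite (md_mxE _ _ _ _ sD0).
  have -> : (fun q => D0 q b c) = F (b, c) by apply/funext => q; rewrite mxE.
  have [_ ->] := HF (b, c).
  rewrite /= -[RHS](congr1 (fun x => Omega p x b c) (tanv_md sf f_inj p u)).
  by rewrite -Omega_sum; apply: eq_bigr => a _; rewrite (md_mxE _ _ _ _ sf).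
(* The entrywise primitive [D0] need not be skew. Its skew part is, and has the same derivative
   because Omega is skew. *)
exists (fun p => 2^-1 *: (D0 p - (D0 p)^T)); split.
- by apply: msmoothZ; apply: msmoothB => //; exact: msmooth_trmx.
- by move=> p; rewrite linearZ /= linearB /= trmxK -scalerN opprB.
move=> p u; rewrite (mdZ _ _ _ (msmoothB sD0 (msmooth_trmx sD0))).
rewrite (mdB _ _ sD0 (msmooth_trmx sD0)) (md_trmx _ _ sD0) dD0 Omega_skew opprK.
by move: (Omega p u) => A; apply/matrixP => b c; rewrite !mxE; lra.
Qed.

End Connection_form.

(** * The rotation field of an infinitesimal bending *)

(** Each cyclic shift of the arguments changes the sign, and three shifts restore the order. *)
Lemma sym_skew_eq0 (R : realType) (A : Type) (P : A -> Prop) (S : A -> A -> A -> R) :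
  (forall x y z, P x -> P y -> S x y z = S y x z) ->
  (forall x y z, S x y z = - S x z y) ->
  forall x y z, P x -> P y -> P z -> S x y z = 0.
Proof.
move=> Ssym Sskew x y z Px Py Pz.
have e1 : S x y z = - S y z x by rewrite Ssym// Sskew.
have e2 : S y z x = - S z x y by rewrite Ssym// Sskew.
have e3 : S z x y = - S x y z by rewrite Ssym// Sskew.
lra.
Qed.

Section Bending_to_rotation.
Context {R : realType} {n m : nat} {M : smoothManifold R n}.
Variables (g : M -> 'rV[R]_n -> 'rV[R]_n -> R)
  (nabla : (M -> 'rV[R]_n) -> (M -> 'rV[R]_n) -> (M -> 'rV[R]_n))
  (f : M -> 'rV[R]_m)
  (alpha beta : M -> 'rV[R]_n -> 'rV[R]_n -> 'rV[R]_m)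
  (E : M -> 'rV[R]_n -> 'rV[R]_m -> 'rV[R]_m).
Hypothesis nabla_lc : levi_civita g nabla.
Hypothesis f_isom : isometric_immersion g f.
Hypothesis alpha_sff : second_fundamental_form nabla f alpha.
Hypothesis beta_tensor : tensor_TTN f beta.
Hypothesis E_tensor : tensor_TNN f E.
Hypothesis E_skew : forall X eta xi,
    vfield X -> normal_section f eta -> normal_section f xi -> forall p,
    dotr (E p (X p) (eta p)) (xi p) + dotr (E p (X p) (xi p)) (eta p) = 0.
Implicit Types (X Y Z W : M -> 'rV[R]_n) (eta : M -> 'rV[R]_m) (p q : M).

Let sf : smooth f. Proof. by case: f_isom. Qed.
Let f_inj p : injective (md f p). Proof. by case: f_isom. Qed.
Let alpha_t : tensor_TTN f alpha := alpha_sff.1.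
Local Notation tanv := (tanv f).
Local Notation nproj := (nproj f).
Local Notation tproj := (tproj f).
Let nnp p x : normal_vector f p (x *m nproj p). Proof. exact: normal_nproj. Qed.
Let nK p w : normal_vector f p w -> w *m nproj p = w. Proof. exact: normal_nprojK. Qed.
Let dN p x y : dotr (x *m nproj p) y = dotr x (y *m nproj p).
Proof. by rewrite dotr_mulmx nproj_tr. Qed.

Variables (T : M -> 'rV[R]_m) (C : M -> 'rV[R]_m -> 'rV[R]_m).
Hypothesis T_bending : infinitesimal_bending f T.
Hypothesis C_skew : skew_endo f C.

Let sT : smooth T := T_bending.1.

(* rotation_mx is T_* on tangent vectors and Y + C on normal ones, Y being the map
   bending_Y of T. *)
Definition bending_mx p : 'M[R]_m := lin1_mx (fun x => md T p (tanv p x)).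
Definition endo_mx p : 'M[R]_m := lin1_mx (fun x => C p (x *m nproj p)).
Definition rotation_mx p : 'M[R]_m := bending_mx p - nproj p *m (bending_mx p)^T + endo_mx p.

Lemma bending_mxE p x : x *m bending_mx p = md T p (tanv p x).
Proof.
rewrite mul_rV_lin1_linear// => a y z.
by rewrite (tanv_linear f p a y z); exact: (@md_linear _ _ _ _ T p sT).
Qed.

Lemma endo_mxE p x : x *m endo_mx p = C p (x *m nproj p).
Proof.
rewrite mul_rV_lin1_linear// => a y z.
by rewrite mulmxDl -scalemxAl (se_linear C_skew).
Qed.

Lemma nproj_bending_mx p : nproj p *m bending_mx p = 0.
Proof.
apply: mulmx_rV_eq => x; rewrite mulmx0 mulmxA bending_mxE.
by rewrite (tanv_normal sf f_inj (nnp _ _)) md0.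
Qed.

Lemma rotation_md p u : md T p u = md f p u *m rotation_mx p.
Proof.
rewrite /rotation_mx (mulmxDr (md f p u)) (mulmxBr (md f p u)) bending_mxE (tanv_md sf f_inj).
rewrite mulmxA endo_mxE (md_nproj sf f_inj) mul0mx subr0.
by have := endo_mxE p 0; rewrite !mul0mx => <-; rewrite addr0.
Qed.

Lemma rotation_normal p w : normal_vector f p w -> w *m rotation_mx p *m nproj p = C p w.
Proof.
move=> nw; rewrite /rotation_mx (mulmxDr w) (mulmxBr w) bending_mxE.
rewrite (tanv_normal sf f_inj nw) md0 sub0r mulmxA (nK nw) endo_mxE (nK nw) mulmxDl.
rewrite (nK (se_normal C_skew nw)) mulNmx -mulmxA.
have -> : (bending_mx p)^T *m nproj p = 0.
  by rewrite -(nproj_tr f p) -trmx_mul nproj_bending_mx trmx0.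
by rewrite mulmx0 oppr0 add0r.
Qed.

Lemma bending_tangent p u v : dotr (md T p u) (md f p v) + dotr (md f p u) (md T p v) = 0.
Proof.
have [X [vX <-]] := vfield_at sf f_inj p u; have [Y [vY <-]] := vfield_at sf f_inj p v.
exact: T_bending.2.
Qed.

Lemma endo_mx_skew p : (endo_mx p)^T = - endo_mx p.
Proof.
apply: skew_trmx => x y; rewrite !endo_mxE.
rewrite -(nK (se_normal C_skew (nnp p x))) -(nK (se_normal C_skew (nnp p y))) dN -(dN p x).
exact: (se_skew C_skew).
Qed.

(** The tangent-to-tangent block is skew by the bending equation, the mixed blocks by the term with
    the transpose, the normal block by skewness of C. *)
Lemma rotation_skew p : (rotation_mx p)^T = - rotation_mx p.
Proof.
have tE : tproj p = 1%:M - nproj p by rewrite [nproj p]/(1%:M - tproj p) opprB addrC subrK.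
have bs : (bending_mx p *m tproj p)^T = - (bending_mx p *m tproj p).
  apply: skew_trmx => x y; rewrite (mulmxA x (bending_mx p)) (mulmxA y (bending_mx p)) !bending_mxE.
  have dP z z' : dotr (z *m tproj p) z' = dotr z (z' *m tproj p) by rewrite dotr_mulmx tproj_tr.
  by rewrite dP -(dP x) -!(md_tanv sf) bending_tangent.
have trB (A B : 'M[R]_m) : (A - B)^T = A^T - B^T by rewrite linearB.
have trD (A B : 'M[R]_m) : (A + B)^T = A^T + B^T by rewrite linearD.
move: bs; rewrite tE (mulmxBr (bending_mx p)) mulmx1 trB trmx_mul (nproj_tr f p).
rewrite /rotation_mx trD trB trmx_mul trmxK (nproj_tr f p) endo_mx_skew.
move: (bending_mx p) (endo_mx p) (nproj p) => A B N.
move: (A *m N) (N *m A^T) (A^T) => a b c H.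
by apply/matrixP => i j; have := congr1 (fun x : 'M[R]_m => x i j) H; rewrite !mxE; lra.
Qed.

Lemma smooth_rotation : smooth rotation_mx.
Proof.
have sb : smooth bending_mx.
  apply/msmooth_mxP => i j.
  have vf := vfield_tanv sf f_inj (@msmooth_cst R n M _ (delta_mx 0 i : 'rV[R]_m)).
  have := (msmooth_mxP _).1 (smooth_md_vfield sT vf) 0 j.
  by congr smooth; apply/funext => p; rewrite -bending_mxE -rowE mxE.
have se : smooth endo_mx.
  apply/msmooth_mxP => i j.
  have ns := normal_section_nproj sf f_inj (@msmooth_cst R n M _ (delta_mx 0 i : 'rV[R]_m)).
  have := (msmooth_mxP _).1 (se_smooth C_skew ns) 0 j.
  by congr smooth; apply/funext => p; rewrite -endo_mxE -rowE mxE.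
apply: msmoothD => //; apply: msmoothB => //; apply: msmooth_mulmx; last exact: msmooth_trmx.
exact: smooth_nproj.
Qed.

Hypothesis C_beta : forall X Y, vfield X -> vfield Y -> forall p,
  assoc_beta nabla f T X Y p = beta p (X p) (Y p) + C p (alpha p (X p) (Y p)).
Hypothesis C_E : forall X eta, vfield X -> normal_section f eta -> forall p,
  assoc_E g f alpha T p (X p) (eta p) = E p (X p) (eta p) - covder_NN f C X eta p.

(** Not the L of the associated pair, which is the differential of T, but the derivative of the
    rotation field. *)
Let L X p := md rotation_mx p (X p).

Let L_skew X p : (L X p)^T = - L X p.
Proof.
rewrite /L -(md_trmx p (X p) smooth_rotation) -(mdN p (X p) smooth_rotation).
by apply: (congr1 (fun F => md F p (X p))); apply/funext => q; exact: rotation_skew.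
Qed.

Let derive_T X Y p (vX : vfield X) (vY : vfield Y) :=
  derive_bending f_isom alpha_sff smooth_rotation rotation_md p vX vY.

(** In [derive_T], B(X, Y) is symmetric by [torsion] for T, and the term with alpha is symmetric
    too. *)
Let L_sym X Y p : vfield X -> vfield Y -> md f p (Y p) *m L X p = md f p (X p) *m L Y p.
Proof.
move=> vX vY; have := derive_T p vX vY; have := derive_T p vY vX.
have := torsion nabla_lc p sT vX vY; rewrite (mdvB _ _ _ sT).
rewrite (alpha_sym nabla_lc f_isom alpha_sff p (Y p) (X p)) .
rewrite -![md rotation_mx p _]/(L _ p).
move: (md T p (nabla X Y p)) (md T p (nabla Y X p)) (md (fun q => md T q (Y q)) p (X p))
  (md (fun q => md T q (X q)) p (Y p)) (alpha p (X p) (Y p) *m rotation_mx p)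
  (md f p (Y p) *m L X p) (md f p (X p) *m L Y p) => a b c d e h k H1 H2 H3.
apply/rowP => j; move: (congr1 (fun x : 'rV[R]_m => x 0 j) H1)
  (congr1 (fun x : 'rV[R]_m => x 0 j) H2)
  (congr1 (fun x : 'rV[R]_m => x 0 j) H3); rewrite !mxE; lra.
Qed.

Let L_tangent X Y Z p : vfield X -> vfield Y -> vfield Z ->
  dotr (md f p (Y p) *m L X p) (md f p (Z p)) = 0.
Proof.
apply: (@sym_skew_eq0 R _ vfield (fun X Y Z => dotr (md f p (Y p) *m L X p) (md f p (Z p)))).
  by move=> A B V vA vB; apply: (congr1 (fun x => dotr x _)); exact: L_sym.
move=> A B V; exact: etrans (dotr_skew _ _ (L_skew A p)) (congr1 -%R (dotrC _ _)).
Qed.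

Let L_normal X Y p : vfield X -> vfield Y ->
  md f p (Y p) *m L X p *m nproj p = beta p (X p) (Y p).
Proof.
move=> vX vY; have := C_beta vX vY p.
rewrite (assoc_betaE f_isom alpha_sff smooth_rotation rotation_md p vX vY).
rewrite (rotation_normal (ttn_normal alpha_t p (X p) (Y p))) addrC.
exact: addIr.
Qed.

Lemma derive_rotation p u : md rotation_mx p u = Omega f beta E p u.
Proof.
have [X [vX <-]] := vfield_at sf f_inj p u.
have OJ := Omega_md f_isom beta_tensor E_tensor.
apply/eqP; rewrite -subr_eq0; apply/eqP; rewrite -/(L X p).
apply: (skew_eq0 f_isom (p := p)).
- have trB (A B : 'M[R]_m) : (A - B)^T = A^T - B^T by rewrite linearB.
  by rewrite trB L_skew (Omega_skew beta f_isom E_tensor E_skew) opprB opprK addrC.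
- move=> v; have [Y [vY <-]] := vfield_at sf f_inj p v.
  rewrite mulmxBr OJ -(L_normal p vX vY).
  apply: dotr_inj => y; rewrite dot0r dotrBl dN.
  have -> : y = md f p (tanv p y) + y *m nproj p by rewrite (md_tanv sf); exact: tnproj.
  have [Z [vZ <-]] := vfield_at sf f_inj p (tanv p y).
  rewrite dotrDr L_tangent// mulmxDl (md_nproj sf f_inj) !add0r.
  by rewrite -mulmxA nproj_idem// subrr.
- move=> w nw; have [eta [neta <-]] := normal_section_at sf f_inj nw.
  have [_ ne] := neta.
  rewrite (mulmxBr (eta p)) mulmxBl (Omega_normal f_isom beta_tensor E_tensor _ (ne p)).
  have := C_E vX neta p.
  rewrite (assoc_EE f_isom alpha_sff smooth_rotation rotation_skew rotation_md p vX neta).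
  rewrite -/(L X p).
  (* [assoc_EE] involves the endomorphism induced by the rotation field, which agrees with C on
     normal vectors; the covariant derivative evaluates both on normal vectors only. *)
  have -> : covder_NN f (fun p w => w *m rotation_mx p *m nproj p) X eta p = covder_NN f C X eta p.
    rewrite /covder_NN.
    have -> : (fun q => eta q *m rotation_mx q *m nproj q) = (fun q => C q (eta q)).
      by apply/funext => q; exact: (rotation_normal (ne q)).
    by rewrite rotation_normal// /normal_conn (normal_partE sf f_inj); exact: nnp.
  by move/addIr ->; rewrite subrr.
Qed.

End Bending_to_rotation.

(** * Existence and uniqueness of the bending *)

Lemma md0_eq_cst (R : realType) (n a b : nat) (M : smoothManifold R n)
  (M_sc : simply_connected R M) (F : M -> 'M[R]_(a, b)) :
  smooth F -> (forall p v, md F p v = 0) -> forall p q, F p = F q.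
Proof.
move=> sF F0 p q; apply/matrixP => i j.
have sFij := (msmooth_mxP _).1 sF i j.
apply: (md0_cst M_sc sFij) => x v.
by rewrite -(md_mxE x v i j sF) F0 mxE.
Qed.

(** Component c of the form f_* u D is the sum over b of D_bc df_b, so the entries of D serve as
    coefficients and the symmetry assumption is exactly closedness. *)
Lemma rotation_primitive (R : realType) (n m : nat) (M : smoothManifold R n)
  (M_sc : simply_connected R M) (f : M -> 'rV[R]_m) (D : M -> 'M[R]_m) :
  smooth f -> smooth D ->
  (forall p u v, md f p v *m md D p u = md f p u *m md D p v) ->
  exists T : M -> 'rV[R]_m, smooth T /\ forall p u, md T p u = md f p u *m D p.
Proof.
move=> sf sD fD.
have sfa b : smooth (fun q => f q 0 b) by exact: ((msmooth_mxP _).1 sf 0 b).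
have sDbc b c : smooth (fun q => D q b c) by exact: ((msmooth_mxP _).1 sD b c).
have wE c p u v : \sum_b md (fun q => D q b c) p u * md (fun q => f q 0 b) p v =
    (md f p v *m md D p u) 0 c.
  by rewrite mxE; apply: eq_bigr => b _; rewrite mulrC (md_mxE p u b c sD) (md_mxE p v 0 b sf).
have ex c : exists F : M -> R, smooth F /\
    forall q v, md F q v = \sum_b D q b c * md (fun r => f r 0 b) q v.
  apply: (@exact_form _ _ _ _ (fun b q => D q b c) (fun b q => f q 0 b)) => // p u v.
  by rewrite !wE fD.
have [F HF] := choice ex.
pose T p : 'rV[R]_m := \row_c F c p.
have sT : smooth T.
  apply/msmooth_mxP => i c; have [+ _] := HF c.
  by congr smooth; apply/funext => p; rewrite mxE.
exists T; split=> // p u; apply/rowP => c; rewrite (md_mxE p u 0 c sT) mxE.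
have -> : (fun q => T q 0 c) = F c by apply/funext => q; rewrite mxE.
have [_ ->] := HF c; apply: eq_bigr => b _.
by rewrite (md_mxE p u 0 b sf) mulrC.
Qed.

Theorem theorem6 (R : realType) (n m : nat) (M : smoothManifold R n)
  (g : M -> 'rV[R]_n -> 'rV[R]_n -> R)
  (nabla : (M -> 'rV[R]_n) -> (M -> 'rV[R]_n) -> (M -> 'rV[R]_n))
  (f : M -> 'rV[R]_m)
  (alpha beta : M -> 'rV[R]_n -> 'rV[R]_n -> 'rV[R]_m)
  (E : M -> 'rV[R]_n -> 'rV[R]_m -> 'rV[R]_m)
  (M_sc : simply_connected R M)
  (g_metric : riemannian_metric g)
  (nabla_lc : levi_civita g nabla)
  (f_isom : isometric_immersion g f)
  (alpha_sff : second_fundamental_form nabla f alpha)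
  (beta_tensor : tensor_TTN f beta)
  (beta_sym : forall p u v, beta p u v = beta p v u)
  (E_tensor : tensor_TNN f E)
  (E_skew : forall X eta xi,
    vfield X -> normal_section f eta -> normal_section f xi -> forall p,
    dotr (E p (X p) (eta p)) (xi p) + dotr (E p (X p) (xi p)) (eta p) = 0)
  (pair_neq0 : (exists p u v, beta p u v != 0) \/
               (exists p u w, normal_vector f p w /\ E p u w != 0))
  (gauss_eq : forall X Y Z, vfield X -> vfield Y -> vfield Z -> forall p,
    shape_op g alpha p (beta p (Y p) (Z p)) (X p)
      + shape_op g beta p (alpha p (Y p) (Z p)) (X p)
    = shape_op g alpha p (beta p (X p) (Z p)) (Y p)
      + shape_op g beta p (alpha p (X p) (Z p)) (Y p))
  (codazzi_eq : forall X Y Z, vfield X -> vfield Y -> vfield Z -> forall p,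
    covder_TTN nabla f beta X Y Z p - covder_TTN nabla f beta Y X Z p
    = E p (Y p) (alpha p (X p) (Z p)) - E p (X p) (alpha p (Y p) (Z p)))
  (ricci_eq : forall X Y eta, vfield X -> vfield Y -> normal_section f eta ->
    forall p,
    covder_TNN nabla f E X Y eta p - covder_TNN nabla f E Y X eta p
    = beta p (X p) (shape_op g alpha p (eta p) (Y p))
      - beta p (shape_op g alpha p (eta p) (X p)) (Y p)
      + alpha p (X p) (shape_op g beta p (eta p) (Y p))
      - alpha p (shape_op g beta p (eta p) (X p)) (Y p)) :
  exists T : M -> 'rV[R]_m,
    [/\ infinitesimal_bending f T,
        has_associated_pair g nabla f alpha T beta E &
        forall T' : M -> 'rV[R]_m,
          infinitesimal_bending f T' ->
          has_associated_pair g nabla f alpha T' beta E ->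
          exists S : M -> 'rV[R]_m,
            trivial_bending f S /\ forall p, T' p = T p + S p].
Proof.
have [sf f_inj _] := f_isom; have alpha_t : tensor_TTN f alpha := alpha_sff.1.
have [D [sD D_skew dD]] := Omega_primitive nabla_lc f_isom alpha_sff beta_tensor beta_sym
  E_tensor E_skew gauss_eq codazzi_eq ricci_eq M_sc.
have OJ := Omega_md f_isom beta_tensor E_tensor.
have [T [sT TD]] : exists T : M -> 'rV[R]_m, smooth T /\ forall p u, md T p u = md f p u *m D p.
  by apply: (rotation_primitive M_sc sf sD) => p u v; rewrite !dD !OJ beta_sym.
exists T; split.
- split=> // X Y _ _ p; rewrite !TD (dotr_skew _ _ (D_skew p)) addrC addrN //.
- exists (fun p w => w *m D p *m nproj f p); split.
  + exact: skew_endo_nproj.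
  + move=> X Y vX vY p.
    rewrite (assoc_betaE f_isom alpha_sff sD TD p vX vY) dD OJ addrC.
    by rewrite (normal_nprojK sf f_inj (ttn_normal beta_tensor p (X p) (Y p))).
  + move=> X eta vX neta p.
    rewrite (assoc_EE f_isom alpha_sff sD D_skew TD p vX neta) dD.
    by rewrite (Omega_normal f_isom beta_tensor E_tensor (X p) (neta.2 p)).
move=> T' T'_bending [C [C_skew C_beta C_E]].
have sT' : smooth T' := T'_bending.1.
have [D' [sD' D'_skew T'D' dD']] : exists D' : M -> 'M[R]_m, [/\ smooth D',
    forall p, (D' p)^T = - D' p, forall p u, md T' p u = md f p u *m D' p &
    forall p u, md D' p u = Omega f beta E p u].
  exists (rotation_mx f T' C); split.
  - exact: (smooth_rotation f_isom T'_bending C_skew).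
  - exact: (rotation_skew f_isom T'_bending C_skew).
  - exact: (rotation_md f_isom T'_bending C_skew).
  - exact: (derive_rotation nabla_lc f_isom alpha_sff beta_tensor E_tensor E_skew
      T'_bending C_skew C_beta C_E).
have [[p0 _] _ _] := M_sc.
pose A := D' p0 - D p0.
have DA p : D' p = D p + A.
  have e : D' p - D p = A.
    apply: (md0_eq_cst M_sc (msmoothB sD' sD)) => q v.
    by rewrite (mdB q v sD' sD) dD' dD subrr.
  by rewrite -e addrC subrK.
(* T' - T and f A have the same derivative, so [S0] is constant; its value is the translation part
   of the trivial bending. *)
pose S0 p := T' p - T p - f p *m A.
have sA : smooth (fun _ : M => A) by exact: msmooth_cst.
have sfA : smooth (fun p => f p *m A) by exact: (msmooth_mulmx sf sA).
have S0E p : S0 p = S0 p0.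
  apply: (md0_eq_cst M_sc (msmoothB (msmoothB sT' sT) sfA)) => q v.
  rewrite (mdB q v (msmoothB sT' sT) sfA) (mdB q v sT' sT) (md_mulmx q v sf sA) md_cst.
  by rewrite T'D' TD DA mulmxDr mulmx0 addr0 addrAC addrK subrr.
exists (fun p => f p *m A + S0 p0); split.
  exists A, (S0 p0); split=> //.
  have trB (B B' : 'M[R]_m) : (B - B')^T = B^T - B'^T by rewrite linearB.
  by rewrite /A trB D'_skew D_skew opprB opprK addrC.
by move=> p; rewrite -(S0E p) /S0 [f p *m A + _]addrC subrK addrC subrK.
Qed.
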